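(* Let $\Gamma$ be an infinite finitely generated group, let $G$ be a Cayley graph of $\Gamma$ (with respect to a finite symmetric generating set), and let $\Phi$, $\Lambda$, and $\operatorname{Gr}^{-1}$ denote the isoperimetric profile, spectral profile, and inverse growth function of $G$. If $\Gamma$ is supermultilateral then the functions $\Phi(2^n)$, $\Lambda(2^n)$, and $\operatorname{Gr}^{-1}(2^n)$ are all doubling.
   Context: Two groups $\Gamma_1,\Gamma_2$ are commensurable, written $\Gamma_1\approx\Gamma_2$, if they have isomorphic subgroups of finite index. A group $\Gamma$ is supermultilateral if it has a subgroup $H$ such that $H\approx\Gamma^m$ for some integer $m>1$, where $\Gamma^m$ is the $m$-fold direct power. For a symmetric stochastic matrix $P$ on a countable set $V$, the isoperimetric profile is $$\Phi_P(n)=\inf\Big\{\frac{1}{|\Omega|}\sum_{x\in\Omega,\,y\in V\setminus\Omega}P(x,y):\ \emptyset\neq\Omega\subset V,\ |\Omega|\leq n\Big\},$$ and the spectral profile is $\Lambda_P(n)=\inf\{\lambda_P(\Omega):\emptyset\neq\Omega\subset V,\ |\Omega|\leq n\}$, where $$\lambda_P(\Omega)=\inf\{\langle (I-P)f,f\rangle:\ \operatorname{support}(f)\subset\Omega,\ \|f\|_2=1\}$$ with $\ell^2(V)$ taken with respect to counting measure. The profiles $\Phi,\Lambda$ of $G$ are those of its simple random walk transition matrix. $\operatorname{Gr}(r)$ is the number of vertices in a ball of radius $r$ in $G$, and $\operatorname{Gr}^{-1}(n)=\inf\{r\geq 0:\operatorname{Gr}(r)\geq n\}$. For a decreasing function $f$,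 ''$f(2^n)$ is doubling'' means that there is a constant $c>0$ with $f(2^{2n})\geq cf(2^n)$ for every $n\geq 1$. For an increasing function $f$, it means that there is a constant $C<\infty$ with $f(2^{2n})\leq Cf(2^n)$ for every $n\geq 1$. *)

(* Defs.v *)
From HB Require Import structures.
From mathcomp Require Import all_boot all_order all_algebra finmap.
From mathcomp Require Import all_classical all_reals all_analysis.

Set Implicit Arguments.
Unset Strict Implicit.
Unset Printing Implicit Defensive.

Import Order.TTheory GRing.Theory Num.Theory.

Local Open Scope classical_set_scope.
Local Open Scope ring_scope.

Section Groups.
Local Open Scope group_scope.

(* [groupType] does not assume finiteness; subgroups are sets of elements of
   an ambient group. *)
Definition subgroup (G : groupType) (H : set G) : Prop :=
  group_closed (mem H).

Definition left_coset (G : groupType) (H : set G) (x : G) : set G :=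
  [set x * h | h in H].

Definition finite_index (G : groupType) (K H : set G) : Prop :=
  [/\ subgroup H, H `<=` K & finite_set [set left_coset H x | x in K]].

(* Only the values of [f] on [A] matter. *)
Definition isomorphic (G1 G2 : groupType) (A : set G1) (B : set G2) : Prop :=
  exists2 f : G1 -> G2,
    set_bij A B f & {in A &, {morph f : x y / x * y}}.

Definition commensurable (G1 G2 : groupType) (H1 : set G1) (H2 : set G2) :
    Prop :=
  exists (A : set G1) (B : set G2),
    [/\ finite_index H1 A, finite_index H2 B & isomorphic A B].

(* [{ffun 'I_m -> G}] carries the pointwise group structure. *)
Definition supermultilateral (G : groupType) : Prop :=
  exists (H : set G) (m : nat),
    [/\ subgroup H, (1 < m)%N & commensurable H [set: {ffun 'I_m -> G}]].

Definition symmetric_generating_set (G : groupType) (S : {fset G}) : Prop :=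
  invg_closed (mem S) /\ smallest (@subgroup G) [set` S] = [set: G].

(* A generating set containing the identity is allowed; it gives a loop at
   each vertex. *)
Definition cayley_graph (G : groupType) (S : {fset G}) : rel G :=
  fun x y => x^-1 * y \in S.

End Groups.

Section Graphs.
Variables (V : choiceType) (e : rel V).

Definition graph_ball (x : V) (r : nat) : set V :=
  [set y | exists p : seq V, [/\ path e x p, last x p = y & (size p <= r)%N]].

(* [fset_set A] is the finite set [A], or the empty set if [A] is infinite;
   in a locally finite graph all the sets below are finite. *)
Definition degree (x : V) : nat := #|` fset_set [set y | e x y]|.

Definition simple_random_walk (R : realType) (x y : V) : R :=
  if e x y then (degree x)%:R^-1 else 0.

End Graphs.

(* The number of vertices of a ball does not depend on its centre, by
   transitivity; radii are integers because graph distances are. *)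
Definition growth (G : groupType) (S : {fset G}) (r : nat) : nat :=
  #|` fset_set (graph_ball (cayley_graph S) 1%g r)|.

Definition inverse_growth (R : realType) (G : groupType) (S : {fset G})
    (n : nat) : R :=
  inf [set r%:R | r in [set r : nat | (n <= growth S r)%N]].

Section Profiles.
Variables (R : realType) (V : choiceType) (P : V -> V -> R).

Definition isoperimetric_ratio (Omega : {fset V}) : R :=
  (#|` Omega|)%:R^-1 *
  fine (\esum_(xy in [set` Omega] `*` ~` [set` Omega]) (P xy.1 xy.2)%:E).

Definition isoperimetric_profile (n : nat) : R :=
  inf [set isoperimetric_ratio Omega | Omega in
        [set Omega : {fset V} | Omega != fset0 /\ (#|` Omega| <= n)%N]].

(* Both sums below run over the support of the summand and are only used for
   finitely supported [f], for which they are the usual sums. *)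
Definition dotp (f g : V -> R) : R := \sum_(x \in [set: V]) f x * g x.

Definition transition_op (f : V -> R) (x : V) : R :=
  \sum_(y \in [set: V]) P x y * f y.

Definition l2norm (f : V -> R) : R := Num.sqrt (dotp f f).

Definition spectral_value (Omega : {fset V}) : R :=
  inf [set dotp (fun x => f x - transition_op f x) f | f in
        [set f : V -> R | [set x | f x != 0] `<=` [set` Omega] /\
                          l2norm f = 1]].

Definition spectral_profile (n : nat) : R :=
  inf [set spectral_value Omega | Omega in
        [set Omega : {fset V} | Omega != fset0 /\ (#|` Omega| <= n)%N]].

End Profiles.

(* "f(2^n) is doubling", for a decreasing and an increasing [f]. *)
Definition doubling_decreasing (R : realType) (f : nat -> R) : Prop :=
  exists2 c : R, 0 < c &
    forall n : nat, (1 <= n)%N -> c * f (2 ^ n)%N <= f (2 ^ (2 * n))%N.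

Definition doubling_increasing (R : realType) (f : nat -> R) : Prop :=
  exists C : R,
    forall n : nat, (1 <= n)%N -> f (2 ^ (2 * n))%N <= C * f (2 ^ n)%N.

(* Main.v *)
(* If [G] is supermultilateral, a finite index subgroup [K] of [G] has two
   commuting copies in [G] meeting trivially, hence [K * K] embeds in [G].
   Retracting [G] onto [K] turns this into Lipschitz maps [G * G -> G] whose
   images cover [G] with bounded multiplicity.  A function [f] on [G] thus becomes
   a family of functions on [G * G], the energies of whose slices are controlled
   by that of [f].  If [f] has support of size about [n ^ 2], few horizontal
   slices have support larger than [n]; the mass on the other ones is controlled
   by the profile at [n], and the mass on the exceptional ones by truncating the
   vertical slices so that their support has size at most [n].  This gives
   [Profile (n ^ 2) >= c * Profile (C * n)], both for the l^1 energy (the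
   isoperimetric profile, by the coarea formula) and for the l^2 energy (the
   spectral profile); likewise [Gr (C * r) >= c * Gr r ^ 2].  Using this twice
   absorbs the constant [C], except at finitely many scales, where positivity of
   the profile suffices. *)
Require Import Defs.
From HB Require Import structures.
From mathcomp Require Import all_boot all_order all_algebra finmap.
From mathcomp Require Import all_classical all_reals all_analysis.
From mathcomp Require Import ring lra zify.

Set Implicit Arguments.
Unset Strict Implicit.
Unset Printing Implicit Defensive.

Import Order.TTheory GRing.Theory Num.Theory.

Local Open Scope classical_set_scope.
Local Open Scope ring_scope.

(** * Finite index subgroups and coarse products *)

Section Subgroups.
Local Open Scope group_scope.
Variable G : groupType.
Implicit Types (H K : set G) (x y : G).

Lemma subgroup1 H : subgroup H -> H 1.
Proof. by case=> /set_mem. Qed.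

Lemma subgroupV H x : subgroup H -> H x -> H x^-1.
Proof. by move=> /group_closedV gH /mem_set /gH /set_mem. Qed.

Lemma subgroupM H x y : subgroup H -> H x -> H y -> H (x * y).
Proof.
by move=> /group_closedM gH /mem_set Hx /mem_set Hy; apply/set_mem/gH.
Qed.

Lemma subgroupMl H x y : subgroup H -> H x -> H (x * y) -> H y.
Proof.
by move=> sH Hx Hxy; rewrite -(mulKg x y); apply: subgroupM => //; apply: subgroupV.
Qed.

Lemma is_subgroup H : H 1 -> (forall x y, H x -> H y -> H (x * y)) ->
  (forall x, H x -> H x^-1) -> subgroup H.
Proof.
move=> H1 HM HV; split; first exact/mem_set.
by move=> x y /set_mem Hx /set_mem Hy; apply/mem_set/HM => //; apply: HV.
Qed.

Lemma left_cosetE H x : left_coset H x = [set y | H (x^-1 * y)].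
Proof.
apply/seteqP; split=> [_ [h Hh <-]|y Hy] /=; first by rewrite mulKg.
by exists (x^-1 * y) => //; rewrite mulVKg.
Qed.

Lemma generated_ind (S : {fset G}) (P : G -> Prop) :
  symmetric_generating_set S -> subgroup [set x | P x] ->
  (forall s, s \in S -> P s) -> forall x, P x.
Proof.
move=> [_ genS] sP PS x.
by have : [set: G] x by []; rewrite -genS; apply.
Qed.

(** [t] picks a representative of each right coset of [K]. Since [finite_index] counts left cosets,
    the choice is made in the left coset of [y^-1] and then inverted. *)
Lemma coset_section K : finite_index [set: G] K ->
  exists t : G -> G, [/\ finite_set (range t), forall y, K (y * (t y)^-1) &
    forall k y, K k -> t (k * y) = t y].
Proof.
move=> [sK _ finK].
pose t y := (xget 1 (left_coset K y^-1))^-1.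
exists t; split.
- have -> : range t = (fun C => (xget 1 C)^-1) @` [set left_coset K x | x in setT].
    apply/seteqP; split=> [_ [y _ <-]|_ [_ [y _ <-] <-]].
      by exists (left_coset K y^-1) => //; exists y^-1.
    by exists y^-1 => //; rewrite /t invgK.
  exact: finite_image.
- move=> y; rewrite /t invgK; case: xgetP => [_ -> |/(_ y^-1)].
    by rewrite left_cosetE /= invgK.
  by rewrite left_cosetE /= mulVg => nK; case: nK; apply: subgroup1.
- move=> k y Kk; rewrite /t; congr (xget 1 _)^-1.
  rewrite !left_cosetE; apply/seteqP; split=> z /=; rewrite !invgK -mulgA.
    exact: subgroupMl.
  exact: subgroupM.
Qed.

End Subgroups.

(** * Commuting copies of a finite index subgroup and coarse product maps *)

Section CoarseProduct.
Local Open Scope group_scope.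
Variable G : groupType.

(** For a subgroup [K], the last clause makes [a k * b l] determine both [k] and [l]: the copies are
    faithful and meet trivially. *)
Definition commuting_copies (K : set G) (a b : G -> G) : Prop :=
  [/\ {in K &, {morph a : x y / x * y}}, {in K &, {morph b : x y / x * y}},
      forall k l, K k -> K l -> a k * b l = b l * a k &
      forall k l, K k -> K l -> a k * b l = 1 -> k = 1 /\ l = 1].

(** Two coordinate embeddings into the power commute and meet trivially. They are restricted to the
    elements that both send into [B] and are composed with the inverse of [f]. *)
Lemma supermultilateral_commuting_copies : supermultilateral G ->
  exists (K : set G) (a b : G -> G),
    finite_index [set: G] K /\ commuting_copies K a b.
Proof.
move=> [H [m [sH m1 [A [B [[sA AH _] [sB _ finB] [f fbij fM]]]]]]].
have [fAB finj fsurj] := fbij.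
have m0 : (0 < m)%N by apply: leq_trans m1.
pose i0 := Ordinal m0; pose i1 := Ordinal m1.
pose iota (i : 'I_m) (x : G) : {ffun 'I_m -> G} :=
  [ffun j => if j == i then x else 1].
have iotaM i x y : iota i (x * y) = iota i x * iota i y.
  by apply/ffunP => j; rewrite !ffunE; case: eqP => // _; rewrite mulg1.
have iota1 i : iota i 1 = 1.
  by apply/ffunP => j; rewrite !ffunE if_same.
have iotaV i x : iota i x^-1 = (iota i x)^-1.
  by apply/ffunP => j; rewrite !ffunE; case: eqP => // _; rewrite invg1.
have iota_comm x y : iota i0 x * iota i1 y = iota i1 y * iota i0 x.
  apply/ffunP => j; rewrite !ffunE; case: eqP => [->|_]; last first.
    by rewrite mulg1 mul1g.
  by rewrite /= mulg1 mul1g.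
pose K := [set x | B (iota i0 x) /\ B (iota i1 x)].
(* [g] inverts [f] on [B]; elsewhere its value is arbitrary. *)
have g_ex (y : {ffun 'I_m -> G}) : exists x : G, B y -> A x /\ f x = y.
  have [By|nBy] := pselect (B y); last by exists 1.
  by have [x Ax <-] := fsurj y By; exists x.
have [g gP] := choice g_ex.
have gM y y' : B y -> B y' -> g (y * y') = g y * g y'.
  move=> By By'; have [Ay fy] := gP _ By; have [Ay' fy'] := gP _ By'.
  have [Ayy' fyy'] := gP _ (subgroupM sB By By').
  apply: finj; [exact/mem_set|exact/mem_set/(subgroupM sA)|].
  by rewrite fyy' fM ?fy ?fy'//; exact/mem_set.
have g1 : g 1 = 1.
  have B1 := subgroup1 sB; apply: (mulgI (g 1)).
  by rewrite -gM// !mulg1.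
exists K, (g \o iota i0), (g \o iota i1); split; last first.
  split=> /=.
  - by move=> x y /set_mem[Bx _] /set_mem[By _]; rewrite /= iotaM gM.
  - by move=> x y /set_mem[_ Bx] /set_mem[_ By]; rewrite /= iotaM gM.
  - by move=> k l [Bk _] [_ Bl]; rewrite -!gM// iota_comm.
  - move=> k l [Bk _] [_ Bl]; rewrite -gM// => kl1.
    have [_] := gP _ (subgroupM sB Bk Bl); rewrite kl1.
    have [_ ] := gP _ (subgroup1 sB); rewrite g1 => -> /ffunP kl.
    have := kl i0; have := kl i1.
    by rewrite !ffunE/= mulg1 mul1g => <- <-.
split=> //.
  apply: is_subgroup; rewrite /K /=.
  - by rewrite !iota1; split; apply: subgroup1.
  - by move=> x y [? ?] [? ?]; rewrite !iotaM; split; apply: subgroupM.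
  - by move=> x [? ?]; rewrite !iotaV; split; apply: subgroupV.
(* A left coset of [K] is the intersection of the pullbacks of two left cosets of [B], so there are
   finitely many. *)
pose meet (C : set {ffun 'I_m -> G} * set {ffun 'I_m -> G}) :=
  iota i0 @^-1` C.1 `&` iota i1 @^-1` C.2.
apply: sub_finite_set (finite_image meet (finite_setX finB finB)).
move=> _ [x _ <-].
exists (left_coset B (iota i0 x), left_coset B (iota i1 x)).
  by split; [exists (iota i0 x)|exists (iota i1 x)].
rewrite /meet !left_cosetE /=; apply/seteqP.
by split=> y /=; rewrite /K /= !iotaM !iotaV.
Qed.

(* [Th x] is a Lipschitz map from [G * G] to [G]; together, the [Th x] for [x]
   in [X] cover [G] with multiplicity at most [#|` Z|]. *)
Definition coarse_product (S W : {fset G}) (Z : {fset G * G}) (X : set G)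
    (Th : G -> G -> G -> G) (lab : G * G -> G * G) : Prop :=
  [/\ forall x y z s, s \in S -> exists2 w, w \in W & Th x (y * s) z = Th x y z * w,
      forall x y z s, s \in S -> exists2 w, w \in W & Th x y (z * s) = Th x y z * w,
      forall yz, lab yz \in Z,
      {in X `*` [set: G * G] &,
        injective (fun u => (Th u.1 u.2.1 u.2.2, lab u.2))} &
      forall w, exists u, X u.1 /\ Th u.1 u.2.1 u.2.2 = w].

(** Dividing [y] by its representative [t y] gives [k y] in [K], and [Th x y z] is
    [x * (a (k y) * b (k z))], with [x] running over representatives of the cosets of the product of
    the two copies. The label [(t y, t z)] restores what [k] forgets. *)
Lemma supermultilateral_coarse_product (S : {fset G}) : supermultilateral G ->
  exists W Z X Th lab, coarse_product S W Z X Th lab.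
Proof.
move=> /supermultilateral_commuting_copies [K [a [b [fiK [aM bM ab_comm ab_inj]]]]].
have [sK _ _] := fiK.
have [t [fint tK tKM]] := coset_section fiK.
have K1 := subgroup1 sK.
have KV x : K x -> K x^-1 by exact: subgroupV.
have KM x y : K x -> K y -> K (x * y) by exact: subgroupM.
have {}aM x y : K x -> K y -> a (x * y) = a x * a y.
  by move=> Kx Ky; rewrite aM ?inE.
have {}bM x y : K x -> K y -> b (x * y) = b x * b y.
  by move=> Kx Ky; rewrite bM ?inE.
have a1 : a 1 = 1 by apply: (mulgI (a 1)); rewrite mulg1 -aM ?mulg1.
have b1 : b 1 = 1 by apply: (mulgI (b 1)); rewrite mulg1 -bM ?mulg1.
have aV x : K x -> a x^-1 = (a x)^-1.
  by move=> Kx; apply: (mulgI (a x)); rewrite -aM ?mulgV//; exact: KV.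
have bV x : K x -> b x^-1 = (b x)^-1.
  by move=> Kx; apply: (mulgI (b x)); rewrite -bM ?mulgV//; exact: KV.
pose k y := y * (t y)^-1.
have kK y : K (k y) by exact: tK.
have ktE y : k y * t y = y by rewrite /k mulgVK.
(* [t (y * s)] depends only on [t y] and [s], so the increments [u] of [k] along generators take
   finitely many values; their images under [a] and [b] form [W]. *)
pose u (c : G * G) := c.1 * c.2 * (t (c.1 * c.2))^-1.
have tS y s : t (y * s) = t (t y * s).
  by rewrite -{1}(ktE y) -mulgA (tKM (k y)).
have kS y s : k (y * s) = k y * u (t y, s).
  by rewrite {1}/k tS -{1}(ktE y) /u /= !mulgA.
have uK y s : K (u (t y, s)).
  by apply: (@subgroupMl _ K (k y)) => //; rewrite -kS.
pose p y := a (k y); pose q y := b (k y).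
pose Tset := fset_set (range t).
have tT y : t y \in Tset by rewrite in_fset_set//; apply/mem_set; exists y.
pose W := ((fun c => a (u c)) @` (Tset `*` S) `|` (fun c => b (u c)) @` (Tset `*` S))%fset.
(* [Q w] is the coset of [w] modulo the product of the two copies; [rho] chooses one point in each
   coset and [X] collects these points. *)
pose Q w := [set v | exists k1 l1, [/\ K k1, K l1 & v = w * (a k1 * b l1)]].
have QM w k1 l1 : K k1 -> K l1 -> Q (w * (a k1 * b l1)) = Q w.
  move=> Kk1 Kl1; apply/seteqP; split=> _ [k2 [l2 [Kk2 Kl2 ->]]].
    exists (k1 * k2), (l1 * l2); split; [exact: KM|exact: KM|].
    rewrite aM// bM// -!mulgA; congr (w * (_ * _)).
    by rewrite !mulgA ab_comm.
  exists (k1^-1 * k2), (l1^-1 * l2); split; [by apply: KM=> //; apply: KV..|].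
  rewrite aM ?bM//; [|exact: KV..]; rewrite aV// bV// -!mulgA; congr (w * _).
  have -> : a k2 * ((b l1)^-1 * b l2) = (b l1)^-1 * (a k2 * b l2).
    by rewrite -bV// !mulgA ab_comm//; exact: KV.
  have -> : (a k1)^-1 * ((b l1)^-1 * (a k2 * b l2)) = (b l1)^-1 * ((a k1)^-1 * (a k2 * b l2)).
    by rewrite -bV// -aV// !mulgA ab_comm//; exact: KV.
  by rewrite !mulgA mulgK mulgV mul1g.
have Qw w : Q w w.
  by exists 1, 1; split=> //; rewrite a1 b1 !mulg1.
pose rho w := xget 1 (Q w).
have rhoP w : Q w (rho w) by rewrite /rho; apply: xgetPex; exists w.
pose X := [set x | rho x = x].
have QE w v : Q w v -> Q v = Q w by move=> [k1 [l1 [Kk Kl ->]]]; exact: QM.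
pose Th x y z : G := x * (p y * q z).
exists W, (Tset `*` Tset)%fset, X, Th, (fun yz => (t yz.1, t yz.2)).
split.
- move=> x y z s Ss; exists (a (u (t y, s))).
    rewrite in_fsetU; apply/orP; left; apply/imfsetP; exists (t y, s) => //=.
    by rewrite in_fsetM /= tT.
  by rewrite /Th /p kS aM// -!mulgA; congr (_ * (_ * _)); exact: ab_comm.
- move=> x y z s Ss; exists (b (u (t z, s))).
    rewrite in_fsetU; apply/orP; right; apply/imfsetP; exists (t z, s) => //=.
    by rewrite in_fsetM /= tT.
  by rewrite /Th /q kS bM// !mulgA.
- by move=> yz; rewrite in_fsetM /= !tT.
(* Equal values lie in the same coset, which gives [x = x']; then [ab_inj] identifies the [K] parts
   and the labels identify the rest. *)
- move=> [x [y z]] [x' [y' z']] /set_mem[/= Xx _] /set_mem[/= Xx' _] [].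
  rewrite /Th => E ty tz.
  have xx' : x = x'.
    rewrite -Xx -Xx' /rho; congr (xget 1 _).
    by rewrite -(@QM x (k y) (k z))// -(@QM x' (k y') (k z'))// E.
  move: E; rewrite -xx' => /mulgI E.
  have [ky kz] : (k y')^-1 * k y = 1 /\ k z * (k z')^-1 = 1.
    apply: ab_inj; [by apply: KM => //; apply: KV..|].
    rewrite (aM _ _ (KV _ (kK _)) (kK _)) (bM _ _ (kK _) (KV _ (kK _))) aV// bV//.
    by rewrite mulgA -(mulgA _ (a _)) E !mulgA mulVg mul1g mulgV.
  have {}ky : k y = k y' by rewrite -(mulg1 (k y')) -ky mulVKg.
  have {}kz : k z = k z' by rewrite -(mul1g (k z')) -kz mulgVK.
  by rewrite -(ktE y) -(ktE z) ky kz ty tz !ktE.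
- move=> w; have [k1 [l1 [Kk1 Kl1 rw]]] := rhoP w.
  have t1K : K (t 1) by rewrite -(invgK (t 1)); apply: KV; rewrite -(mul1g (_^-1)).
  (* The factor [t 1] produces a preimage of [k'] under [k] even when [t 1] is not the identity. *)
  have kE k' : K k' -> k (k' * t 1) = k'.
    move=> Kk'; rewrite /k (tKM k')//.
    by rewrite -[in X in _ / X](mulg1 (t 1)) (tKM (t 1))// mulgK.
  exists (rho w, (k1^-1 * t 1, l1^-1 * t 1)) => /=; split.
    by rewrite /X /= {1}/rho (QE _ _ (rhoP w)).
  rewrite /Th /p /q !kE//; [|exact: KV..].
  rewrite rw aV// bV// -!mulgA ![b l1 * _]mulgA -(aV k1)// -ab_comm//; last exact: KV.
  by rewrite aV// mulgK mulgV mulg1.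
Qed.

End CoarseProduct.

(** * Mass, energy and gaps *)

Section Esum.
Local Open Scope ereal_scope.
Variable R : realType.
Implicit Types T : choiceType.

Lemma esumZl T (D : set T) (k : R) (a : T -> \bar R) :
  (0 <= k)%R -> (forall x, 0 <= a x) ->
  \esum_(x in D) (k%:E * a x) = k%:E * \esum_(x in D) a x.
Proof.
move=> k0 a0; rewrite /esum -ereal_supZl//; last first.
  by apply/set0P; exists (\sum_(x \in set0) a x), set0 => //; exact: fsets_set0.
rewrite image_comp; congr (ereal_sup (_ @` _)); apply/funext => A /=.
by rewrite ge0_mule_fsumr.
Qed.

Lemma esumZl_EFin T (D : set T) (k : R) (a : T -> R) :
  (0 <= k)%R -> (forall x, (0 <= a x)%R) ->
  \esum_(x in D) (k * a x)%:E = k%:E * \esum_(x in D) (a x)%:E.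
Proof.
by move=> k0 a0; rewrite -esumZl.
Qed.

Lemma esum_swap T T' (a : T -> T' -> \bar R) : (forall x y, 0 <= a x y) ->
  \esum_(x in [set: T]) \esum_(y in [set: T']) a x y =
  \esum_(y in [set: T']) \esum_(x in [set: T]) a x y.
Proof.
move=> a0; rewrite !esum_esum//.
rewrite (@reindex_esum _ _ _ ([set: T'] `*`` fun=> [set: T]) _ (fun u => (u.2, u.1)))//.
split=> //; first by move=> [? ?] [? ?] _ _ [-> ->].
by move=> [x y] _; exists (y, x).
Qed.

Lemma esum_pair T T' (a : T -> T' -> \bar R) : (forall x y, 0 <= a x y) ->
  \esum_(x in [set: T]) \esum_(y in [set: T']) a x y =
  \esum_(u in [set: T * T']) a u.1 u.2.
Proof.
move=> a0; rewrite esum_esum//; congr esum.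
by apply/seteqP; split=> [[]|[]].
Qed.

Lemma subset_esum T (A B : set T) (a : T -> \bar R) : A `<=` B ->
  \esum_(x in A) a x <= \esum_(x in B) a x.
Proof.
move=> AB; apply: ge_ereal_sup => _ [X [finX XA] <-].
by apply: ereal_sup_ubound; exists X => //; split=> // x /XA /AB.
Qed.

Lemma esum_inj_le T T' (A : set T) (B : set T') (e : T -> T')
    (a : T' -> \bar R) : set_inj A e -> (forall x, A x -> B (e x)) ->
  \esum_(x in A) a (e x) <= \esum_(y in B) a y.
Proof.
move=> einj eAB; rewrite -esum_image//; apply: subset_esum.
by move=> _ [x Ax <-]; exact: eAB.
Qed.

Lemma sume_const (I : Type) (r : seq I) (x : \bar R) : 0 <= x ->
  \sum_(i <- r) x = (size r)%:R%:E * x.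
Proof.
move=> x0; elim: r => [|i r IH]; first by rewrite big_nil mul0e.
by rewrite big_cons IH /= -[in RHS]add1n natrD EFinD ge0_muleDl ?mul1e// lee_fin.
Qed.

(** Absorbs a real term into the left side even when [X] is infinite, as an energy may be. *)
Lemma lee_real_cancel (k d r : R) (X : \bar R) :
  (k * r)%:E <= X + (d * r)%:E -> ((k - d) * r)%:E <= X.
Proof.
case: X => [x| |]; last by rewrite addNye.
  by rewrite -EFinD !lee_fin mulrBl lerBlDr.
by move=> _; exact: leey.
Qed.

End Esum.

(** * Gap inequalities and truncation *)

Section Gap.
Local Open Scope ereal_scope.
Variable R : realType.

(** For [p > 0], the [p]-th power of the l^p norm, possibly infinite. *)
Definition mass (V : choiceType) (p : nat) (f : V -> R) : \bar R :=
  \esum_(x in [set: V]) (`|f x| ^+ p)%:E.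

Definition support_size (V : choiceType) (f : V -> R) : \bar R :=
  \esum_(x in [set: V]) ((f x != 0)%R%:R)%:E.

Lemma mass_ge0 (V : choiceType) p (f : V -> R) : 0 <= mass p f.
Proof. by apply: esum_ge0 => x _; rewrite lee_fin; exact: exprn_ge0. Qed.

Lemma real_root (p : nat) (r : R) : (0 < p)%N -> (0 <= r)%R ->
  exists2 t : R, (0 <= t)%R & (t ^+ p = r)%R.
Proof.
move=> p0 r0; exists (r `^ p%:R^-1)%R; first exact: powR_ge0.
by rewrite -powR_mulrn ?powR_ge0// -powRrM mulVf ?powRr1// pnatr_eq0 -lt0n.
Qed.

Variables (G : groupType) (S : {fset G}).

(** When [S] is symmetric every edge is counted in both directions, whence the factors 2 in the
    comparisons with the profiles. *)
Definition energy (p : nat) (f : G -> R) : \bar R :=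
  \esum_(x in [set: G]) \sum_(s <- S) (`|f x - f (x * s)%g| ^+ p)%:E.

(* The best constants [lam] are, up to normalisation, the isoperimetric profile
   for [p = 1] and the spectral profile for [p = 2]. *)
Definition gap (p n : nat) (lam : R) : Prop :=
  forall f : G -> R, support_size f <= n%:R%:E -> mass p f < +oo ->
  lam%:E * mass p f <= energy p f.

Lemma energy_ge0 p f : 0 <= energy p f.
Proof.
by apply: esum_ge0 => x _; apply: sume_ge0 => s _; rewrite lee_fin; exact: exprn_ge0.
Qed.

(* Truncating at the height [t] with [t ^+ p = mass p h / n] leaves a function
   with support of size at most [n], and costs little on the set [L]. *)
Lemma gap_truncation (p n : nat) (lam : R) (L : pred G) (h : G -> R) :
  (0 < p)%N -> (0 < n)%N -> (0 <= lam)%R -> gap p n lam -> mass p h < +oo ->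
  (2 ^+ p.+1 : R)%:E * (\esum_(z in [set: G]) ((L z)%:R : R)%:E) <= n%:R%:E ->
  (lam * 2 ^- p)%:E * (\esum_(z in [set: G]) ((L z)%:R * `|h z| ^+ p)%:E) <=
    energy p h + (lam * 2 ^- p.+1)%:E * mass p h.
Proof.
move=> p0 n0 lam0 gapn hoo cardL.
have hfin : mass p h \is a fin_num by rewrite ge0_fin_numE ?mass_ge0.
set H := fine (mass p h); have massE : mass p h = H%:E by rewrite fineK.
have H0 : (0 <= H)%R by rewrite -lee_fin -massE mass_ge0.
have i2p0 q : (0 <= 2 ^- q :> R)%R by rewrite invr_ge0 exprn_ge0.
(* Zero mass is treated apart because the truncation level [t] has to be positive. *)
have [HE|Hpos] := eqVneq H 0%R.
  apply: (@le_trans _ _ 0); last first.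
    by rewrite adde_ge0 ?energy_ge0// mule_ge0 ?mass_ge0// lee_fin mulr_ge0.
  rewrite -(mule0 (lam * 2 ^- p)%:E) lee_wpmul2l ?lee_fin ?mulr_ge0//.
  rewrite -[leRHS]/(0%:E) -HE -massE; apply: le_esum => z _; rewrite lee_fin.
  by case: (L z); rewrite ?mul1r// mul0r exprn_ge0.
have {}Hpos : (0 < H)%R by rewrite lt_def Hpos.
have nR0 : (0 < n%:R :> R)%R by rewrite ltr0n.
have [t t0 tp] := real_root p0 (divr_ge0 H0 (ltW nR0)).
have tp0 : (0 < t ^+ p)%R by rewrite tp divr_gt0.
pose h' (z : G) : R := Num.max (`|h z| - t)%R 0%R.
have h'0 z : (0 <= h' z)%R by rewrite le_max lexx orbT.
have h'h z : (`|h' z| <= `|h z|)%R.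
  by rewrite ger0_norm// ge_max normr_ge0 andbT lerBlDr lerDl.
have h'oo : mass p h' < +oo.
  apply: le_lt_trans hoo; apply: le_esum => z _.
  by rewrite lee_fin lerXn2r ?nnegrE.
(* Chebyshev's inequality: [h] is at least [t] in absolute value where [h'] is nonzero, and [n]
   times [t ^+ p] is the whole mass. *)
have supph' : support_size h' <= n%:R%:E.
  rewrite -(@lee_pmul2l _ (t ^+ p)%:E) ?lte_fin// -esumZl_EFin//; last exact: ltW.
  rewrite -EFinM tp divfK ?gt_eqF// -massE.
  apply: le_esum => z _; rewrite lee_fin.
  case: eqP => /= [_|/eqP hz]; first by rewrite mulr0 exprn_ge0.
  rewrite mulr1 -tp lerXn2r ?nnegrE//.
  move: hz; rewrite /h'; case: leP => // ht.
  by rewrite max_r ?eqxx// subr_le0 ltW.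
(* Truncation is 1-Lipschitz, so no increment grows. *)
have Eh' : energy p h' <= energy p h.
  apply: le_esum => z _; apply: lee_sum => s _; rewrite lee_fin lerXn2r ?nnegrE//.
  have := lerB_dist (h z) (h (z * s)%g); have := lerB_dist (h (z * s)%g) (h z).
  rewrite (distrC (h (z * s)%g)) /h'.
  case: (leP (`|h z| - t)%R 0%R); case: (leP (`|h (z * s)%g| - t)%R 0%R);
  by rewrite ler_norml => *; apply/andP; split; lra.
(* If the absolute value of [h z] is at most [2 * t], the term [t ^+ p] suffices; otherwise [h' z]
   is at least half of it. *)
have pt z : (2 ^- p * ((L z)%:R * `|h z| ^+ p) <= `|h' z| ^+ p + t ^+ p * (L z)%:R)%R.
  case: (L z); rewrite ?mul1r ?mul0r ?mulr0 ?mulr1 ?addr0 ?exprn_ge0//.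
  rewrite -exprVn -exprMn.
  have [h2t|h2t] := leP `|h z|%R (2 * t)%R.
    apply: ler_wpDl; first by rewrite exprn_ge0.
    by rewrite lerXn2r ?nnegrE// ?mulr_ge0//; lra.
  apply: ler_wpDr; first exact: ltW.
  rewrite lerXn2r ?nnegrE ?mulr_ge0// (ger0_norm (h'0 z)) le_max.
  by apply/orP; left; lra.
rewrite EFinM -muleA -esumZl_EFin//.
apply: (@le_trans _ _ (lam%:E * (mass p h' +
    (t ^+ p)%:E * (\esum_(z in [set: G]) ((L z)%:R : R)%:E)))).
  rewrite lee_wpmul2l ?lee_fin// -esumZl_EFin//; last exact: ltW.
  rewrite -esumD; [|by move=> z _; rewrite lee_fin ?exprn_ge0// mulr_ge0// ltW..].
  by apply: le_esum => z _; rewrite -EFinD lee_fin.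
rewrite ge0_muleDr ?mass_ge0//; last first.
  by rewrite mule_ge0 ?lee_fin ?(ltW tp0)//; apply: esum_ge0 => z _; rewrite lee_fin.
apply: leeD; first by apply: le_trans Eh'; exact: gapn.
rewrite EFinM -muleA lee_wpmul2l ?lee_fin//.
rewrite massE tp mulrC EFinM -EFinM mulrC.
rewrite -(@lee_pmul2l _ (2 ^+ p.+1)%:E) ?lte_fin ?exprn_gt0//.
rewrite -EFinM mulVKf ?gt_eqF ?exprn_gt0//.
rewrite muleCA; apply: (le_trans (lee_wpmul2l _ cardL)); first by rewrite lee_fin divr_ge0// ltW.
by rewrite -EFinM divfK ?gt_eqF.
Qed.

End Gap.

(** * Gaps on products *)

Section GapProduct.
Local Open Scope ereal_scope.
Variables (R : realType) (G : groupType) (S : {fset G}).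

(* [L] is the set of large horizontal slices: the small ones are controlled by
   their own energy, and there are few enough large ones for truncation to work
   along the vertical slices. *)
Lemma gap_product (p n M : nat) (lam : R) (F : G -> G -> R) :
  (0 < p)%N -> (0 < n)%N -> (0 <= lam)%R -> gap S p n lam ->
  (2 ^ p.+1 * M <= n * n)%N ->
  \esum_(y in [set: G]) support_size (F y) <= M%:R%:E ->
  \esum_(y in [set: G]) mass p (F y) < +oo ->
  (lam * 2 ^- p.+1)%:E * (\esum_(y in [set: G]) mass p (F y)) <=
    \esum_(z in [set: G]) energy S p (F^~ z) + \esum_(y in [set: G]) energy S p (F y).
Proof.
move=> p0 n0 lam0 gapn Mn suppF Foo.
have F0 y z : (0 <= `|F y z| ^+ p)%R by exact: exprn_ge0.
have b0 (b : bool) : (0 <= b%:R :> R)%R by [].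
have nR0 : (0 < n%:R :> R)%R by rewrite ltr0n.
have i2p0 q : (0 <= 2 ^- q :> R)%R by rewrite invr_ge0 exprn_ge0.
pose L z := n%:R%:E < support_size (F^~ z).
have slice_oo z : mass p (F^~ z) < +oo.
  apply: le_lt_trans Foo; apply: le_esum => y _.
  rewrite -[leLHS](@esum_set1 _ _ z (fun z => (`|F y z| ^+ p)%:E)) ?lee_fin//.
  exact: subset_esum.
(* Each large slice contributes more than [n] to a total support of size at most [M]. *)
have cardL : (2 ^+ p.+1 : R)%:E * (\esum_(z in [set: G]) ((L z)%:R : R)%:E) <= n%:R%:E.
  rewrite -(@lee_pmul2l _ n%:R%:E) ?lte_fin// muleCA -esumZl_EFin//.
  apply: (@le_trans _ _ ((2 ^+ p.+1 : R)%:E * M%:R%:E)).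
    rewrite lee_wpmul2l ?lee_fin ?exprn_ge0//; apply: le_trans suppF.
    rewrite esum_swap; last by move=> y z; rewrite lee_fin.
    apply: le_esum => z _; rewrite /L; case: ltP => [/ltW|_]; rewrite ?mulr1//.
    by rewrite mulr0; apply: esum_ge0 => y _; rewrite lee_fin.
  by rewrite -!EFinM lee_fin -natrX -!natrM ler_nat.
have horizontal : lam%:E * (\esum_(z in [set: G]) \esum_(y in [set: G])
      ((~~ L z)%:R * `|F y z| ^+ p)%:E) <= \esum_(z in [set: G]) energy S p (F^~ z).
  rewrite -esumZl//; last by move=> z; apply: esum_ge0 => y _; rewrite lee_fin mulr_ge0.
  apply: le_esum => z _; rewrite esumZl_EFin//.
  rewrite /L; case: ltP => [_|small] /=; first by rewrite mul0e mule0 energy_ge0.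
  by rewrite mul1e; exact: gapn.
have vertical : (lam * 2 ^- p)%:E * (\esum_(y in [set: G]) \esum_(z in [set: G])
      ((L z)%:R * `|F y z| ^+ p)%:E) <= \esum_(y in [set: G]) energy S p (F y) +
      (lam * 2 ^- p.+1)%:E * \esum_(y in [set: G]) mass p (F y).
  rewrite -!esumZl ?mulr_ge0//; last 2 first.
  - by move=> y; exact: mass_ge0.
  - by move=> y; apply: esum_ge0 => z _; rewrite lee_fin mulr_ge0.
  rewrite -esumD; [|by move=> y _; exact: energy_ge0|].
    apply: le_esum => y _; apply: gap_truncation gapn _ cardL => //.
    apply: le_lt_trans Foo.
    rewrite -[leLHS](@esum_set1 _ _ y (fun y => mass p (F y))) ?mass_ge0//.
    exact: subset_esum.
  by move=> y _; rewrite mule_ge0 ?mass_ge0// lee_fin mulr_ge0.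
set N := \esum_(y in [set: G]) mass p (F y) in vertical *.
have N0 : 0 <= N by apply: esum_ge0 => y _; exact: mass_ge0.
have Nfin : N \is a fin_num by rewrite ge0_fin_numE.
have split : N = \esum_(y in [set: G]) \esum_(z in [set: G]) ((L z)%:R * `|F y z| ^+ p)%:E +
    \esum_(z in [set: G]) \esum_(y in [set: G]) ((~~ L z)%:R * `|F y z| ^+ p)%:E.
  rewrite [X in _ + X]esum_swap; last by move=> z y; rewrite lee_fin mulr_ge0.
  rewrite -esumD; [|by move=> y _; apply: esum_ge0 => z _; rewrite lee_fin mulr_ge0..].
  apply: eq_esum => y _; rewrite -esumD; [|by move=> z _; rewrite lee_fin mulr_ge0..].
  by apply: eq_esum => z _; rewrite -EFinD; case: (L z); rewrite /= mul1r mul0r ?addr0 ?add0r.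
have key : (lam * 2 ^- p)%:E * N <= \esum_(z in [set: G]) energy S p (F^~ z) +
    \esum_(y in [set: G]) energy S p (F y) + (lam * 2 ^- p.+1)%:E * N.
  rewrite {1}split ge0_muleDr; last 2 first.
  - by apply: esum_ge0 => y _; apply: esum_ge0 => z _; rewrite lee_fin mulr_ge0.
  - by apply: esum_ge0 => y _; apply: esum_ge0 => z _; rewrite lee_fin mulr_ge0.
  rewrite -addeA addeC; apply: leeD => //; apply: le_trans horizontal.
  apply: lee_wpmul2r.
    by apply: esum_ge0 => y _; apply: esum_ge0 => z _; rewrite lee_fin mulr_ge0.
  by rewrite lee_fin ler_piMr// invf_le1 ?exprn_gt0// exprn_ege1// ler1n.
(* [N] is finite and [2 ^- p - 2 ^- p.+1 = 2 ^- p.+1], so half of the main term absorbs the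
   truncation error. *)
move: key; rewrite -(fineK Nfin) -!EFinM => /lee_real_cancel.
congr (_%:E <= _); congr (_ * _)%R; rewrite -mulrBr; congr (_ * _)%R.
by rewrite exprS invfM; field; rewrite expf_neq0.
Qed.

(** The elements [g] with such a constant form a subgroup containing [S]: products follow from the
    triangle inequality and translation invariance, inverses from the substitution of [x * g] for
    [x]. *)
Lemma translation_energy (p : nat) : (0 < p)%N -> symmetric_generating_set S ->
  forall g : G, exists2 C : R, (0 <= C)%R &
    forall f : G -> R,
    \esum_(x in [set: G]) (`|f x - f (x * g)%g| ^+ p)%:E <= C%:E * energy S p f.
Proof.
move=> p0 genS.
have e0 (f : G -> R) (x y : G) : 0 <= (`|f x - f y| ^+ p)%:E.
  by rewrite lee_fin exprn_ge0.
have shift (g : G) (a : G -> \bar R) :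
    \esum_(x in [set: G]) a (x * g)%g = \esum_(x in [set: G]) a x.
  rewrite [RHS](@reindex_esum _ _ _ [set: G] _ (fun x => (x * g)%g))//.
  split=> //; first by move=> x y _ _; exact: mulIg.
  by move=> y _; exists (y * g^-1)%g => //; rewrite mulgVK.
apply: (generated_ind genS); first apply: is_subgroup => /=.
- exists 0%R => // f; rewrite mul0e esum1// => x _.
  by rewrite mulg1 subrr normr0 expr0n gtn_eqF.
- move=> g h [C C0 gC] [D D0 hD]; exists (2 ^+ p * (C + D))%R.
    by rewrite mulr_ge0 ?exprn_ge0// addr_ge0.
  move=> f.
  apply: (@le_trans _ _ (\esum_(x in [set: G]) ((2 ^+ p : R)%:E *
     ((`|f x - f (x * g)%g| ^+ p)%:E + (`|f (x * g)%g - f (x * g * h)%g| ^+ p)%:E)))).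
    apply: le_esum => x _; rewrite mulgA -EFinD -EFinM lee_fin.
    set a := f x; set b := f (x * g)%g; set c := f (x * g * h)%g.
    have tri : (`|a - c| <= 2 * Num.max `|a - b| `|b - c|)%R.
      by have := ler_distD b a c; case: (leP `|a - b|%R `|b - c|%R); lra.
    apply: (@le_trans _ _ ((2 * Num.max `|a - b| `|b - c|) ^+ p)%R).
      by rewrite lerXn2r ?nnegrE// (le_trans _ tri).
    rewrite exprMn ler_wpM2l ?exprn_ge0//.
    by case: (leP `|a - b|%R `|b - c|%R) => _; rewrite ?lerDl ?lerDr exprn_ge0.
  rewrite esumZl ?exprn_ge0//; last by move=> x; rewrite adde_ge0.
  rewrite esumD// (shift g (fun x => (`|f x - f (x * h)%g| ^+ p)%:E)).
  rewrite EFinM -muleA lee_wpmul2l ?lee_fin ?exprn_ge0// EFinD ge0_muleDl ?lee_fin//.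
  exact: leeD.
- move=> g [C C0 gC]; exists C => // f; apply: le_trans (gC f).
  rewrite -(shift g); apply: le_esum => x _.
  by rewrite mulgK distrC.
- move=> s Ss; exists 1%R => // f; rewrite mul1e.
  apply: le_esum => x _; rewrite (big_fsetD1 s)//= leeDl//.
  exact: sume_ge0.
Qed.

Lemma translations_energy (p : nat) (W : seq G) :
  (0 < p)%N -> symmetric_generating_set S ->
  exists2 C : R, (0 <= C)%R &
    forall f : G -> R,
    \esum_(x in [set: G]) \sum_(w <- W) (`|f x - f (x * w)%g| ^+ p)%:E <=
      C%:E * energy S p f.
Proof.
move=> p0 genS; elim: W => [|w W [C C0 CP]].
  by exists 0%R => // f; rewrite mul0e esum1// => x _; rewrite big_nil.
have [D D0 DP] := translation_energy p0 genS w.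
exists (D + C)%R; first exact: addr_ge0.
move=> f; rewrite EFinD ge0_muleDl ?lee_fin//.
under eq_esum do rewrite big_cons.
rewrite esumD; [|by move=> x _; rewrite ?lee_fin ?exprn_ge0..|].
  exact: leeD.
by move=> x _; apply: sume_ge0 => s _; rewrite lee_fin exprn_ge0.
Qed.

(** * Transferring sums and energies through the coarse product maps *)

Section Coarse.
Variables (W : {fset G}) (Z : {fset G * G}) (X : set G).
Variables (Th : G -> G -> G -> G) (lab : G * G -> G * G).
Hypothesis cp : coarse_product S W Z X Th lab.

(** [Th] together with [lab] is injective, so each [v] is attained at most once for each label in
    [Z]. *)
Lemma coarse_sum_le (phi : G -> \bar R) : (forall v, 0 <= phi v) ->
  \esum_(x in X) \esum_(y in [set: G]) \esum_(z in [set: G]) phi (Th x y z) <=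
  (#|` Z|%:R)%:E * \esum_(v in [set: G]) phi v.
Proof.
move=> phi0; have [_ _ labZ Thinj _] := cp.
under eq_esum => x _ do rewrite (esum_pair (a := fun y z => phi (Th x y z)))//.
rewrite (esum_esum (a := fun x yz => phi (Th x yz.1 yz.2)))//.
apply: (@le_trans _ _ (\esum_(c in [set: G] `*` [set` Z]) phi c.1)).
  apply: (@esum_inj_le _ _ _ _ _ (fun u => (Th u.1 u.2.1 u.2.2, lab u.2)) (fun c => phi c.1)).
    by move=> u u' /set_mem[? _] /set_mem[? _] /Thinj; apply; apply/mem_set.
  by move=> u _; split=> //=; exact: labZ.
rewrite (_ : [set: G] `*` [set` Z] = [set: G] `*`` fun=> [set` Z]); last first.
  by apply/seteqP; split.
rewrite -(esum_esum (a := fun x _ => phi x))//.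
rewrite -esumZl//; apply: le_esum => v _.
by rewrite esum_fset// fsbig_finite//= set_fsetK sume_const.
Qed.

Lemma coarse_sum_ge (phi : G -> \bar R) : (forall v, 0 <= phi v) ->
  \esum_(v in [set: G]) phi v <=
  \esum_(x in X) \esum_(y in [set: G]) \esum_(z in [set: G]) phi (Th x y z).
Proof.
move=> phi0; have [_ _ _ _ /choice[u uP]] := cp.
under [leRHS]eq_esum => x _ do rewrite (esum_pair (a := fun y z => phi (Th x y z)))//.
rewrite (esum_esum (a := fun x yz => phi (Th x yz.1 yz.2)))//.
rewrite [leLHS](_ : _ = \esum_(v in [set: G])
    (fun c => phi (Th c.1 c.2.1 c.2.2)) (u v)); last first.
  by apply: eq_esum => v _ /=; have [_ ->] := uP v.
apply: esum_inj_le.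
  by move=> v v' _ _ uvv'; have [_ <-] := uP v; have [_ <-] := uP v'; rewrite uvv'.
by move=> v _; split=> //; have [] := uP v.
Qed.

(** Moving [y] or [z] by a generator multiplies [Th x y z] by an element of [W]. The constant
    collects the two directions, the generators, and the multiplicity of the covering. *)
Lemma coarse_slice_energy (p : nat) (f : G -> R) :
  \esum_(x in X) (\esum_(z in [set: G]) energy S p (fun y => f (Th x y z)) +
                  \esum_(y in [set: G]) energy S p (fun z => f (Th x y z))) <=
  (2 * #|` S|%:R * #|` Z|%:R)%:E *
    \esum_(v in [set: G]) \sum_(w <- W) (`|f v - f (v * w)%g| ^+ p)%:E.
Proof.
have [ThW1 ThW2 _ _ _] := cp.
pose psi v := \sum_(w <- W) (`|f v - f (v * w)%g| ^+ p)%:E : \bar R.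
have psi0 v : 0 <= psi v by apply: sume_ge0 => w _; rewrite lee_fin exprn_ge0.
have psiW v w : w \in W -> (`|f v - f (v * w)%g| ^+ p)%:E <= psi v.
  move=> wW; rewrite /psi (big_fsetD1 w)//= leeDl//.
  by apply: sume_ge0 => s _; rewrite lee_fin exprn_ge0.
have step (v : G) (v' : G -> G) :
    (forall s, s \in S -> exists2 w, w \in W & v' s = (v * w)%g) ->
    \sum_(s <- S) (`|f v - f (v' s)| ^+ p)%:E <= #|` S|%:R%:E * psi v.
  move=> vW; apply: (@le_trans _ _ (\sum_(s <- S) psi v)).
    rewrite !big_seq; apply: lee_sum => s Ss.
    by have [w wW ->] := vW _ Ss; exact: psiW.
  by rewrite sume_const.
have T0 x : 0 <= \esum_(y in [set: G]) \esum_(z in [set: G]) psi (Th x y z).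
  by apply: esum_ge0 => y _; exact: esum_ge0.
apply: (@le_trans _ _ (\esum_(x in X) ((2 * #|` S|%:R)%:E *
    \esum_(y in [set: G]) \esum_(z in [set: G]) psi (Th x y z)))).
  apply: le_esum => x _.
  rewrite mulrDl mul1r EFinD ge0_muleDl ?lee_fin//.
  apply: leeD.
    rewrite [X in _ * X]esum_swap// -esumZl//; last by move=> y; exact: esum_ge0.
    apply: le_esum => z _; rewrite -esumZl//; apply: le_esum => y _.
    by apply: step => s; exact: ThW1.
  rewrite -esumZl//; last by move=> y; exact: esum_ge0.
  apply: le_esum => y _; rewrite -esumZl//; apply: le_esum => z _.
  by apply: step => s; exact: ThW2.
rewrite esumZl ?mulr_ge0//.
rewrite [X in _ <= X * _]EFinM -muleA lee_wpmul2l ?lee_fin ?mulr_ge0//.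
exact: coarse_sum_le.
Qed.

End Coarse.

(** [gap_product] is applied, for each [x] in [X], to [f] composed with [Th x]. Summing over [x]
    recovers the mass of [f] from below and its energy, up to a constant, from above. *)
Lemma gap_square (p : nat) : (0 < p)%N -> symmetric_generating_set S ->
  supermultilateral G ->
  exists (C : nat) (c : R), (0 < c)%R /\
    forall (n N : nat) (lam : R), (0 < n)%N -> (0 <= lam)%R ->
    (C * N <= n * n)%N -> gap S p n lam -> gap S p N (c * lam).
Proof.
move=> p0 genS /(supermultilateral_coarse_product S) [W [Z [X [Th [lab cp]]]]].
have [D D0 DP] := translations_energy W p0 genS.
(* The summand 1 only keeps [K] positive. *)
pose K : R := (2 * #|` S|%:R * #|` Z|%:R * D + 1)%R.
have K0 : (0 < K)%R by rewrite ltr_wpDl// !mulr_ge0.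
(* The slices have total support at most the cardinality of [Z] times [N], and [gap_product] asks
   for a further factor [2 ^ p.+1]. *)
exists (2 ^ p.+1 * #|` Z|)%N, (2 ^- p.+1 / K)%R; split.
  by rewrite divr_gt0// invr_gt0 exprn_gt0.
move=> n N lam n0 lam0 CN gapn f suppf foo.
have a0 v : 0 <= (`|f v| ^+ p)%:E by rewrite lee_fin exprn_ge0.
have s0 v : 0 <= ((f v != 0)%R%:R : R)%:E by rewrite lee_fin.
have d0 : (0 <= lam * 2 ^- p.+1)%R by rewrite mulr_ge0// invr_ge0 exprn_ge0.
rewrite -(@lee_pmul2l _ K%:E) ?lte_fin// muleA -EFinM.
have -> : (K * (2 ^- p.+1 / K * lam) = lam * 2 ^- p.+1)%R.
  by field; rewrite expf_neq0// gt_eqF.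
pose F x y z := f (Th x y z).
have mF0 x : 0 <= \esum_(y in [set: G]) mass p (F x y).
  by apply: esum_ge0 => y _; exact: mass_ge0.
apply: (@le_trans _ _ (\esum_(x in X) ((lam * 2 ^- p.+1)%:E *
    \esum_(y in [set: G]) mass p (F x y)))).
  rewrite esumZl// lee_wpmul2l ?lee_fin//.
  exact: (coarse_sum_ge cp (phi := fun v => (`|f v| ^+ p)%:E)).
apply: (@le_trans _ _ (\esum_(x in X)
    (\esum_(z in [set: G]) energy S p (fun y => f (Th x y z)) +
     \esum_(y in [set: G]) energy S p (fun z => f (Th x y z))))); last first.
  apply: (le_trans (coarse_slice_energy cp p f)).
  apply: le_trans (lee_wpmul2l _ (DP f)) _; first by rewrite lee_fin !mulr_ge0.
  by rewrite muleA -EFinM lee_wpmul2r ?energy_ge0// lee_fin lerDl.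
apply: le_esum => x Xx.
have one (a : G -> \bar R) : (forall x, 0 <= a x) -> a x <= \esum_(x in X) a x.
  move=> a_ge0; rewrite -[leLHS](@esum_set1 _ _ x a)//; apply: subset_esum.
  by move=> _ ->.
apply: (@gap_product p n (#|` Z| * N)) => //.
- by rewrite mulnA.
- apply: (le_trans (one (fun x => \esum_(y in [set: G]) support_size (F x y)) _)).
    by move=> x'; apply: esum_ge0 => y _; apply: esum_ge0 => z _; rewrite lee_fin.
  apply: (le_trans (coarse_sum_le cp (phi := fun v => ((f v != 0)%R%:R : R)%:E) _)) => //.
  by rewrite natrM EFinM lee_wpmul2l// lee_fin.
- apply: (le_lt_trans (one (fun x => \esum_(y in [set: G]) mass p (F x y)) mF0)).
  apply: (le_lt_trans (coarse_sum_le cp (phi := fun v => (`|f v| ^+ p)%:E) _)) => //.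
  by rewrite lte_mul_pinfty ?lee_fin.
Qed.

End GapProduct.

(** * Doubling from gaps *)

Section Doubling.
Variable R : realType.

(** Here [h j] stands for a profile at [2 ^ j], so the shift [a] is a constant factor in the
    argument. Halving [j + a] and using the hypothesis again removes the shift once [j] is large. *)
Lemma doubling_of_square (h : nat -> R) (a : nat) (c : R) : 0 < c ->
  (forall j, (0 < j)%N -> 0 < h j) ->
  (forall i j, (0 < i)%N -> (i <= j)%N -> h j <= h i) ->
  (forall j, (0 < j)%N -> c * h (j + a)%N <= h (2 * j)%N) ->
  exists2 c' : R, 0 < c' & forall j, (0 < j)%N -> c' * h j <= h (2 * j)%N.
Proof.
move=> c0 hpos hmono hsq.
(* Beyond [3 * a], rounding included, [uphalf (j + a) + a] is at most [j]; the finitely many smaller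
   [j] are handled by positivity and monotonicity. *)
pose J := (3 * a).+1.
exists (Num.min (c * c) (h (2 * J)%N / h 1%N)).
  by rewrite lt_min !mulr_gt0// ?invr_gt0 hpos.
move=> j j0; have hj0 := ltW (hpos j j0).
have [jJ|Jj] := leqP j J.
  apply: (@le_trans _ _ (h (2 * J)%N / h 1%N * h j)).
    by rewrite ler_wpM2r// ge_min lexx orbT.
  apply: (@le_trans _ _ (h (2 * J)%N)); last by apply: hmono; rewrite /J in jJ *; lia.
  rewrite mulrAC ler_pdivrMr ?hpos// ler_wpM2l ?hmono//.
  by rewrite ltW// hpos.
apply: (@le_trans _ _ (c * c * h j)); first by rewrite ler_wpM2r// ge_min lexx.
apply: le_trans (hsq j j0); rewrite -mulrA ler_pM2l//.
pose u := uphalf (j + a).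
have uE : (j + a <= 2 * u <= (j + a).+1)%N by rewrite /u; lia.
apply: (@le_trans _ _ (h (2 * u)%N)); last by apply: hmono; lia.
apply: le_trans (hsq u _); last by lia.
by rewrite ler_pM2l//; apply: hmono; rewrite /J in Jj; lia.
Qed.

End Doubling.

Section Support.
Local Open Scope ereal_scope.
Variables (R : realType) (V : choiceType).

Lemma esum_fsupport (F : V -> R) (U : {fset V}) : (forall x, (0 <= F x)%R) ->
  (forall x, x \notin U -> F x = 0%R) ->
  \esum_(x in [set: V]) (F x)%:E = (\sum_(x <- U) F x)%R%:E.
Proof.
move=> F0 FU; rewrite -sumEFin; apply/eqP; rewrite eq_le; apply/andP; split.
  rewrite -(set_fsetK U) -fsbig_finite// -esum_fset//; last by move=> x _; rewrite lee_fin.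
  rewrite [leRHS]esum_mkcond; apply: le_esum => x _.
  by case: ifPn => //; rewrite notin_setE => /negP /FU ->.
rewrite -[in leLHS](set_fsetK U) -fsbig_finite// -esum_fset//; last by move=> x _; rewrite lee_fin.
exact: subset_esum.
Qed.

Lemma support_size_fset (f : V -> R) (U : {fset V}) :
  (forall x, x \notin U -> f x = 0%R) -> support_size f <= #|` U|%:R%:E.
Proof.
move=> fU; rewrite /support_size (@esum_fsupport _ U)//; last first.
  by move=> x /fU ->; rewrite eqxx.
rewrite lee_fin; apply: (@le_trans _ _ (\sum_(x <- U) 1)%R).
  by apply: ler_sum => x _; rewrite lern1 leq_b1.
by rewrite big_const_seq count_predT iter_addr_0.
Qed.

Lemma support_fset (f : V -> R) (n : nat) : support_size f <= n%:R%:E ->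
  exists U : {fset V}, (#|` U| <= n)%N /\ forall x, (x \in U) = (f x != 0%R).
Proof.
move=> fn; pose A := [set x | f x != 0%R].
have cardA (U : {fset V}) : [set` U] `<=` A -> (#|` U| <= n)%N.
  move=> UA; rewrite -(ler_nat R) -lee_fin; apply: le_trans fn.
  apply: (@le_trans _ _ (\esum_(x in [set` U]) ((f x != 0)%R%:R)%:E)); last exact: subset_esum.
  rewrite esum_fset// fsbig_finite//= set_fsetK sumEFin lee_fin.
  rewrite big_seq (eq_bigr (fun=> 1%R)) -?big_seq; last by move=> x /UA /= ->.
  by rewrite big_const_seq count_predT iter_addr_0.
have finA : finite_set A.
  apply: contrapT => /(infinite_set_fset n.+1) [B BA].
  by rewrite leqNgt ltnS cardA.
exists (fset_set A); split; first by apply: cardA; rewrite fset_setK.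
by move=> x; rewrite in_fset_set//; apply/idP/idP => [/set_mem|?]; [|apply/mem_set].
Qed.

End Support.

(** * From gap inequalities to doubling *)

Section GapDoubling.
Local Open Scope ereal_scope.
Variables (R : realType) (G : groupType) (S : {fset G}) (p : nat).
Hypotheses (p0 : (0 < p)%N) (genS : symmetric_generating_set S).
Hypothesis infG : infinite_set [set: G].

(* Among the [n + 1] translates [x * g], one lies outside the support of [f]. *)
Lemma gap_positive (n : nat) : exists2 lam : R, (0 < lam)%R & gap S p n lam.
Proof.
have [B _ nB] := infinite_set_fset n.+1 infG.
have [C C0 CP] := translations_energy R B p0 genS.
have C10 : (0 < C + 1)%R by rewrite ltr_wpDl.
exists ((C + 1)^-1)%R; first by rewrite invr_gt0.
move=> f suppf _; have [U [Un UE]] := support_fset suppf.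
rewrite -(@lee_pmul2l _ (C + 1)%:E) ?lte_fin// muleA -EFinM divff ?gt_eqF// mul1e.
apply: (@le_trans _ _ (C%:E * energy S p f)); last first.
  by rewrite lee_wpmul2r ?energy_ge0// lee_fin lerDl.
apply: le_trans (CP f); apply: le_esum => x _.
have [g gB xgU] : exists2 g, g \in B & (x * g)%g \notin U.
  apply: contrapT => noB.
  have : ([fset (x * g)%g | g in B] `<=` U)%fset.
    apply/fsubsetP => _ /imfsetP[g /= gB ->]; apply: contrapT => /negP ?.
    by apply: noB; exists g.
  move=> /fsubset_leq_card; rewrite card_imfset; last exact: mulgI.
  by move=> /(leq_trans nB); rewrite leqNgt ltnS Un.
rewrite (big_fsetD1 g)//=; move: xgU; rewrite UE negbK => /eqP ->.
by rewrite subr0 leeDl//; apply: sume_ge0 => w _; rewrite lee_fin exprn_ge0.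
Qed.

Lemma gap_anti (m n : nat) (lam : R) : (m <= n)%N -> gap S p n lam -> gap S p m lam.
Proof.
move=> mn gapn f suppf; apply: gapn; apply: le_trans suppf _.
by rewrite lee_fin ler_nat.
Qed.

(** By [gapE] the best gap constant at [n] is [k * h n], so statements about gaps become
    inequalities between values of [h]. *)
Lemma gap_doubling (h : nat -> R) (k : R) : supermultilateral G -> (0 < k)%R ->
  (forall n, (0 < n)%N -> (0 <= h n)%R) ->
  (forall n lam, (0 < n)%N -> (0 <= lam)%R -> gap S p n lam <-> (lam <= k * h n)%R) ->
  doubling_decreasing h.
Proof.
move=> smG k0 h0 gapE.
have [C [c [c0 sq]]] := gap_square R p0 genS smG.
have e2 j : (0 < 2 ^ j)%N by rewrite expn_gt0.
have kh0 j : (0 <= k * h (2 ^ j)%N)%R by rewrite mulr_ge0 ?h0// ltW.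
have gap_h j : gap S p (2 ^ j)%N (k * h (2 ^ j)%N) by apply/gapE.
apply: (@doubling_of_square R (fun j => h (2 ^ j)%N) C c) => //.
- move=> j _; have [lam lam0] := gap_positive (2 ^ j)%N.
  rewrite (gapE _ _ (e2 j) (ltW lam0)) => /(lt_le_trans lam0).
  by rewrite pmulr_rgt0.
- move=> i j _ ij; rewrite -(ler_pM2l k0) -gapE//.
  by apply: gap_anti (gap_h j); rewrite leq_exp2l.
- move=> j _; rewrite -(ler_pM2l k0) mulrCA -gapE//; last exact: mulr_ge0 (ltW c0) _.
  (* Since [C <= 2 ^ C], the factor [C] is absorbed by shifting the exponent by [C]. *)
  apply: (sq (2 ^ (j + C))%N) => //.
  rewrite -expnD addnACA !addnn -[j.*2]mul2n expnD [(C * _)%N]mulnC leq_mul//.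
  by rewrite (leq_trans (ltnW (ltn_expl C (ltnSn 1))))// leq_exp2l// -addnn leq_addr.
Qed.

End GapDoubling.

(** * The spectral profile *)

(** The empty set is included, its [inf] being 0 by convention. *)
Lemma inf_nonneg (R : realType) (A : set R) :
  (forall x, A x -> 0 <= x) -> 0 <= inf A.
Proof.
move=> A0; have [->|/set0P Ane] := eqVneq A set0; first by rewrite inf0.
by apply: lb_le_inf => // x /A0.
Qed.

Section Walk.
Variables (R : realType) (G : groupType) (S : {fset G}).
Hypotheses (genS : symmetric_generating_set S) (infG : infinite_set [set: G]).

Local Notation P := (simple_random_walk (cayley_graph S) R).
Local Notation d := (#|` S|%:R : R).

Lemma generating_set_card_gt0 : (0 < #|` S|)%N.
Proof.
rewrite cardfs_gt0; apply/eqP => S0; apply: infG.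
apply: (@sub_finite_set _ _ [set 1%g]); last exact: finite_set1.
move=> x _; apply: (generated_ind genS) x; last by rewrite S0.
apply: is_subgroup => //= [x y -> ->|x ->]; first by rewrite mulg1.
by rewrite invg1.
Qed.

Let d_gt0 : 0 < d. Proof. by rewrite ltr0n generating_set_card_gt0. Qed.

Let dd_gt0 : 0 < 2 * d. Proof. exact: mulr_gt0. Qed.

Lemma degree_cayley x : degree (cayley_graph S) x = #|` S|.
Proof.
rewrite /degree (_ : [set y | _] = [set` [fset (x * s)%g | s in S]%fset]); last first.
  apply/seteqP; split=> [y Sy|_ /imfsetP[s /= Ss ->]].
    by apply/imfsetP; exists (x^-1 * y)%g => //; rewrite mulVKg.
  by rewrite /= /cayley_graph mulKg.
by rewrite set_fsetK card_imfset//; exact: mulgI.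
Qed.

Lemma walkE x y : P x y = if (x^-1 * y)%g \in S then d^-1 else 0.
Proof. by rewrite /simple_random_walk degree_cayley. Qed.

Lemma transition_opE f x : transition_op P f x = d^-1 * \sum_(s <- S) f (x * s)%g.
Proof.
rewrite /transition_op (@reindex_fsbigT _ _ _ _ _ (fun s => (x * s)%g)); last first.
  by exists (fun y => (x^-1 * y)%g) => y; rewrite ?mulKg ?mulVKg.
rewrite (fsbigTE S); last by move=> s /negbTE sS; rewrite walkE mulKg sS mul0r.
rewrite mulr_sumr !big_seq; apply: eq_bigr => s Ss.
by rewrite walkE mulKg Ss.
Qed.

(** After expanding the square, translation invariance makes the sums of [f (x * s) ^+ 2] and of
    [f x ^+ 2] equal. *)
Lemma energy_dirichlet (U : {fset G}) (f : G -> R) :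
  (forall x, x \notin U -> f x = 0) ->
  energy S 2 f = (2 * d * dotp (fun x => f x - transition_op P f x) f)%:E.
Proof.
move=> fU.
(* [U'] also contains the points from which a generator leads into [U], so all the sums below are
   supported in it. *)
pose U' := (U `|` [fset (x * s^-1)%g | x in U, s in S])%fset.
have fU'0 x : x \notin U' -> f x = 0.
  by rewrite in_fsetU negb_or => /andP[/fU].
have fU'1 s x : s \in S -> x \notin U' -> f (x * s)%g = 0.
  move=> Ss; rewrite in_fsetU negb_or => /andP[_ xU]; apply: fU.
  apply: contra xU => xsU; apply/imfset2P; exists (x * s)%g => //.
  by exists s => //; rewrite mulgK.
have shift s : s \in S -> \sum_(x <- U') f (x * s)%g ^+ 2 = \sum_(x <- U') f x ^+ 2.
  move=> Ss; rewrite -(fsbigTE _ (fun x => f (x * s)%g ^+ 2)); last first.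
    by move=> x xU'; rewrite (fU'1 _ _ Ss xU') expr0n.
  rewrite -(fsbigTE _ (fun x => f x ^+ 2)); last by move=> x /fU'0 ->; rewrite expr0n.
  rewrite [RHS](@reindex_fsbigT _ _ _ _ _ (fun x => (x * s)%g))//.
  by exists (fun y => (y * s^-1)%g) => y; rewrite ?mulgK ?mulgVK.
rewrite /energy; under eq_esum do rewrite sumEFin.
rewrite (@esum_fsupport _ _ _ U'); last 2 first.
- by move=> x; apply: sumr_ge0 => s _; exact: exprn_ge0.
- move=> x xU'; rewrite big_seq big1// => s Ss.
  by rewrite fU'0// fU'1// subr0 normr0 expr0n.
congr EFin; rewrite /dotp (fsbigTE U'); last by move=> x /fU'0 ->; rewrite mulr0.
transitivity (\sum_(x <- U') \sum_(s <- S) (f x ^+ 2 - 2 * (f x * f (x * s)%g)) +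
              \sum_(s <- S) \sum_(x <- U') f (x * s)%g ^+ 2).
  rewrite [X in _ + X]exchange_big -big_split; apply: eq_bigr => x _.
  rewrite -big_split; apply: eq_bigr => s _ /=.
  by rewrite real_normK ?num_real//; ring.
have -> : \sum_(s <- S) \sum_(x <- U') f (x * s)%g ^+ 2 =
    \sum_(s <- S) \sum_(x <- U') f x ^+ 2.
  by apply: eq_big_seq => s /shift.
rewrite [X in _ + X]exchange_big -big_split mulr_sumr; apply: eq_bigr => x _ /=.
rewrite -big_split transition_opE /=.
rewrite (eq_bigr (fun s => 2 * (f x ^+ 2 - f x * f (x * s)%g))); last by move=> s _; ring.
rewrite -mulr_sumr sumrB big_const_seq count_predT iter_addr_0 -mulr_natl -mulr_sumr.
by field; rewrite gt_eqF.
Qed.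

Lemma dotp_mass (U : {fset G}) (f : G -> R) : (forall x, x \notin U -> f x = 0) ->
  mass 2 f = (dotp f f)%:E.
Proof.
move=> fU; rewrite /mass (@esum_fsupport _ _ _ U)//; last first.
  by move=> x /fU ->; rewrite normr0 expr0n.
congr EFin; rewrite /dotp (fsbigTE U); last by move=> x /fU ->; rewrite mulr0.
by apply: eq_bigr => x _; rewrite real_normK ?num_real// expr2.
Qed.

Let unit_fun (U : {fset G}) :=
  [set f : G -> R | [set x | f x != 0] `<=` [set` U] /\ l2norm f = 1].

Let unit_funP U f : unit_fun U f ->
  [/\ forall x, x \notin U -> f x = 0, mass 2 f = 1%E &
  energy S 2 f = (2 * d * dotp (fun x => f x - transition_op P f x) f)%:E].
Proof.
move=> [fU f1].
have f0 x : x \notin U -> f x = 0 by apply: contraNeq => /fU.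
split=> //; last exact: energy_dirichlet f0.
rewrite (dotp_mass f0); congr EFin.
have dotp0 : 0 <= dotp f f by rewrite -lee_fin -(dotp_mass f0) mass_ge0.
by rewrite -[LHS]sqr_sqrtr// -/(l2norm f) f1 expr1n.
Qed.

Let dirichlet_ge0 U f : unit_fun U f ->
  0 <= dotp (fun x => f x - transition_op P f x) f.
Proof.
move=> /unit_funP[_ _ Ef]; rewrite -(pmulr_rge0 _ dd_gt0).
by rewrite -lee_fin -Ef energy_ge0.
Qed.

Lemma spectral_value_ge0 U : 0 <= spectral_value P U.
Proof.
by apply: inf_nonneg => _ [f fU <-]; exact: dirichlet_ge0 fU.
Qed.

Lemma spectral_profile_ge0 n : 0 <= spectral_profile P n.
Proof. by apply: inf_nonneg => _ [U _ <-]; exact: spectral_value_ge0. Qed.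

Lemma energyZ p (k : R) (f : G -> R) : 0 <= k ->
  energy S p (fun x => k * f x) = ((k ^+ p)%:E * energy S p f)%E.
Proof.
move=> k0; rewrite /energy -esumZl ?exprn_ge0//; last first.
  by move=> x; apply: sume_ge0 => s _; rewrite lee_fin exprn_ge0.
apply: eq_esum => x _; rewrite !sumEFin -EFinM mulr_sumr; congr EFin.
by apply: eq_bigr => s _; rewrite -mulrBr normrM exprMn (ger0_norm k0).
Qed.

Lemma massZ (V : choiceType) p (k : R) (f : V -> R) : 0 <= k ->
  mass p (fun x => k * f x) = ((k ^+ p)%:E * mass p f)%E.
Proof.
move=> k0; rewrite /mass -esumZl ?exprn_ge0//.
by apply: eq_esum => x _; rewrite -EFinM normrM exprMn (ger0_norm k0).
Qed.

(** Unit functions are test functions for the gap; conversely, both sides of the gap inequality are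
    homogeneous of degree 2, so [f] may be normalised. *)
Lemma gap_spectral_profile n (lam : R) : (0 < n)%N -> 0 <= lam ->
  gap S 2 n lam <-> lam <= 2 * d * spectral_profile P n.
Proof.
move=> n0 lam0.
split=> [gapn|lamL].
  rewrite -ler_pdivrMl//; apply: lb_le_inf.
    exists (spectral_value P [fset 1%g]%fset); exists [fset 1%g]%fset => //.
    by split; rewrite ?cardfs1// -cardfs_gt0 cardfs1.
  move=> _ [U [U0 Un] <-]; apply: lb_le_inf.
    have [x xU] := fset0Pn _ U0.
    (* A point mass shows that the infimum is over a nonempty set. *)
    pose f y : R := (y == x)%:R.
    have fU : [set y | f y != 0] `<=` [set` U].
      by move=> y; rewrite /f /=; case: (eqVneq y x) => [-> //|_]; rewrite eqxx.
    exists (dotp (fun x => f x - transition_op P f x) f), f => //; split=> //.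
    rewrite /l2norm /dotp (fsbigTE [fset x]%fset); last first.
      by move=> y; rewrite inE /f => /negbTE ->; rewrite mul0r.
    by rewrite big_seq_fset1 /f eqxx mulr1 sqrtr1.
  move=> _ [f fU <-]; have [f0 mf Ef] := unit_funP fU.
  rewrite ler_pdivrMl// -lee_fin -Ef -[leLHS]mule1 -mf.
  apply: gapn; last by rewrite mf ltry.
  by apply: le_trans (support_size_fset f0) _; rewrite lee_fin ler_nat.
move=> f suppf foo; have [U [Un UE]] := support_fset suppf.
have f0 x : x \notin U -> f x = 0 by rewrite UE negbK => /eqP.
have [mf0|mf0] := eqVneq (mass 2 f) 0%E; first by rewrite mf0 mule0 energy_ge0.
have mE := dotp_mass f0; set m := dotp f f in mE.
have m0 : 0 < m.
  by rewrite lt_def -lee_fin -mE mass_ge0 andbT; apply: contraNneq mf0 => meq; rewrite mE meq.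
pose k := (Num.sqrt m)^-1.
have k0 : 0 <= k by rewrite invr_ge0 sqrtr_ge0.
have k2 : k ^+ 2 = m^-1 by rewrite exprVn sqr_sqrtr// ltW.
pose g x := k * f x.
have g0 x : x \notin U -> g x = 0 by move=> /f0; rewrite /g => ->; rewrite mulr0.
have gU : unit_fun U g.
  split=> [x /=|]; first by apply: contraNT => /g0 ->.
  rewrite /l2norm -[RHS]sqrtr1; congr Num.sqrt; apply: EFin_inj.
  by rewrite -(dotp_mass g0) massZ// mE k2 -EFinM mulVf// gt_eqF.
have [_ _ Eg] := unit_funP gU.
have U0 : U != fset0.
  apply: contraNneq mf0 => U0; rewrite mE; apply/eqP; congr EFin.
  rewrite /m /dotp (fsbigTE U) ?U0 ?big_seq_fset0// => x xU.
  by rewrite f0 ?mul0r// U0.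
have Lg : 2 * d * spectral_profile P n <= 2 * d * dotp (fun x => g x - transition_op P g x) g.
  rewrite ler_pM2l//; apply: (@le_trans _ _ (spectral_value P U)).
    apply: ge_inf; last by exists U.
    by exists 0 => _ [U1 _ <-]; exact: spectral_value_ge0.
  apply: ge_inf; last by exists g.
  by exists 0 => _ [g1 g1U <-]; exact: dirichlet_ge0 g1U.
have := le_trans lamL Lg; rewrite -lee_fin -Eg energyZ// k2 mE.
rewrite -(@lee_pmul2l _ m%:E) ?lte_fin// muleA -!EFinM divff ?gt_eqF// mul1e.
by rewrite mulrC.
Qed.

End Walk.

(** * The isoperimetric profile *)

Section Coarea.
Local Open Scope ereal_scope.
Variables (R : realType) (G : groupType) (S : {fset G}).

Definition fset_indic (U : {fset G}) (x : G) : R := (x \in U)%:R%R.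

Lemma mass_fset_indic (U : {fset G}) : mass 1 (fset_indic U) = #|` U|%:R%:E.
Proof.
rewrite /mass (@esum_fsupport _ _ _ U)//; last first.
  by move=> x /negbTE xU; rewrite /fset_indic xU normr0.
congr EFin; rewrite big_seq (eq_bigr (fun=> 1%R)) -?big_seq; last first.
  by move=> x xU; rewrite /fset_indic xU normr1.
by rewrite big_const_seq count_predT iter_addr_0.
Qed.

(* Discrete coarea formula, peeling off one level set of [f] at a time. *)
Lemma gap_coarea (n : nat) (lam : R) : (0 <= lam)%R ->
  (forall U : {fset G}, U != fset0 -> (#|` U| <= n)%N ->
     (lam * #|` U|%:R)%:E <= energy S 1 (fset_indic U)) ->
  gap S 1 n lam.
Proof.
move=> lam0 lamU.
have nonneg k : forall (U : {fset G}) (f : G -> R), (#|` U| < k)%N -> (#|` U| <= n)%N ->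
    (forall x, 0 <= f x)%R -> (forall x, (x \in U) = (f x != 0%R)) ->
    lam%:E * mass 1 f <= energy S 1 f.
  elim: k => // k IH U f Uk Un f0 UE.
  have [U0|U0] := eqVneq U fset0.
    rewrite /mass esum1 ?mule0 ?energy_ge0// => x _.
    by have := UE x; rewrite U0 inE => /esym/negbFE/eqP ->; rewrite normr0.
  have [x1 x1U] := fset0Pn _ U0.
  (* Subtracting the minimum [m] of [f] on its support removes at least [x0] from the support, so
     the induction proceeds. *)
  have [x0 x0U m_min] : exists2 x0, x0 \in U & forall y, y \in U -> (f x0 <= f y)%R.
    have [i _ imin] := arg_minP (fun i : U => f (val i)) (erefl true : predT [` x1U]%fset).
    by exists (val i) => [|y yU]; [exact: valP|exact: (imin [` yU]%fset)].
  set m := f x0 in m_min.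
  have fU x : x \notin U -> f x = 0%R by rewrite UE negbK => /eqP.
  pose f' x := (f x - m * fset_indic U x)%R.
  have f'0 x : (0 <= f' x)%R.
    rewrite /f' /fset_indic; case: (boolP (x \in U)) => [/m_min|/fU ->].
      by rewrite mulr1 subr_ge0.
    by rewrite mulr0 subr0.
  have [U' [U'n U'E]] : exists U' : {fset G}, (#|` U'| < #|` U|)%N /\
      forall x, (x \in U') = (f' x != 0%R).
    exists [fset x in U | f' x != 0%R]%fset; split.
      apply: fproper_ltn_card; rewrite fproperEneq; apply/andP; split; last first.
        by apply/fsubsetP => x; rewrite !inE => /andP[].
      apply: contraTneq x0U => <-.
      by rewrite !inE /= /f' /fset_indic; case: (x0 \in U); rewrite ?mulr1 ?subrr ?eqxx.
    move=> x; rewrite !inE /=; case: (boolP (x \in U)) => //= xU.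
    by rewrite /f' /fset_indic (negbTE xU) fU// mulr0 subr0 eqxx.
  have m0 : (0 <= m)%R by exact: f0.
  have i0 x : (0 <= fset_indic U x)%R by rewrite /fset_indic.
  have -> : mass 1 f = m%:E * mass 1 (fset_indic U) + mass 1 f'.
    rewrite /mass -esumZl_EFin// -esumD; [|by move=> x _; rewrite lee_fin ?mulr_ge0..].
    apply: eq_esum => x _; rewrite -EFinD; congr EFin.
    by rewrite !ger0_norm// /f' addrC subrK.
  (* Energies add up because [f] is at least [m] on [U] and 0 outside: a jump across the boundary
     splits as [m] plus the rest, and inside [U] the indicator is constant. *)
  have -> : energy S 1 f = m%:E * energy S 1 (fset_indic U) + energy S 1 f'.
    have e0 (a : G -> R) x : 0 <= \sum_(s <- S) (`|a x - a (x * s)%g| ^+ 1)%:E.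
      by apply: sume_ge0 => s _; rewrite lee_fin exprn_ge0.
    rewrite /energy -esumZl// -esumD; last 2 first.
    - by move=> x _; rewrite mule_ge0.
    - by move=> x _; exact: e0.
    apply: eq_esum => x _; rewrite !sumEFin -EFinM -EFinD; congr EFin.
    rewrite mulr_sumr -big_split; apply: eq_bigr => s _ /=.
    rewrite /f' /fset_indic.
    have fm y : y \in U -> (0 <= f y - m)%R by rewrite subr_ge0; exact: m_min.
    case: (boolP (x \in U)) => [xU|/fU ->]; case: (boolP (_ \in U)) => [yU|/fU ->];
      rewrite ?mulr1 ?mulr0 ?subr0 ?sub0r ?subrr ?normr0 ?mulr0 ?add0r ?normrN ?normr1 ?mulr1//.
    + by congr (`| _ |)%R; ring.
    + by rewrite (ger0_norm (f0 x)) (ger0_norm (fm _ xU)); ring.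
    + by rewrite (ger0_norm (f0 _)) (ger0_norm (fm _ yU)); ring.
  rewrite ge0_muleDr ?mass_ge0//; last by rewrite mule_ge0 ?mass_ge0.
  apply: leeD; last first.
    apply: (IH U') => //; first by rewrite (leq_trans U'n).
    by rewrite (leq_trans (ltnW U'n)).
  rewrite muleCA lee_wpmul2l// mass_fset_indic -EFinM.
  exact: lamU.
(* Passing to the absolute value preserves the mass and does not increase the energy. *)
move=> f suppf _; have [U [Un UE]] := support_fset suppf.
have massE : mass 1 f = mass 1 (fun x => `|f x|%R).
  by apply: eq_esum => x _; rewrite normr_id.
rewrite massE; apply: (@le_trans _ _ (energy S 1 (fun x => `|f x|%R))).
  by apply: (nonneg _ U) => // x; rewrite UE normr_eq0.
apply: le_esum => x _; apply: lee_sum => s _.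
by rewrite lee_fin !expr1 ler_dist_dist.
Qed.

End Coarea.

Section Isoperimetric.
Variables (R : realType) (G : groupType) (S : {fset G}).
Hypotheses (genS : symmetric_generating_set S) (infG : infinite_set [set: G]).

Local Notation P := (simple_random_walk (cayley_graph S) R).
Local Notation d := (#|` S|%:R : R).

Let d_gt0 : 0 < d. Proof. by rewrite ltr0n (generating_set_card_gt0 genS infG). Qed.

Definition edge_boundary (U : {fset G}) : R :=
  \sum_(x <- U) \sum_(s <- S) ((x * s)%g \notin U)%:R.

Let indic2 (U : {fset G}) x y : R := ((x \in U) && (y \notin U))%:R.

Let indic2_ge0 U x y : (0 <= (indic2 U x y)%:E)%E. Proof. by rewrite lee_fin. Qed.

Let edge_boundary_esum U :
  (\esum_(x in [set: G]) \sum_(s <- S) (indic2 U x (x * s)%g)%:E)%E =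
  (edge_boundary U)%:E.
Proof.
under eq_esum do rewrite sumEFin.
rewrite (@esum_fsupport _ _ _ U); last 2 first.
- by move=> x; apply: sumr_ge0.
- by move=> x /negbTE xU; rewrite big1// => s _; rewrite /indic2 xU.
congr EFin; apply: eq_big_seq => x xU.
by apply: eq_bigr => s _; rewrite /indic2 xU.
Qed.

(** Each boundary edge is seen once from inside and once from outside; symmetry of [S] makes the two
    counts equal. *)
Lemma energy_fset_indic U : energy S 1 (@fset_indic R G U) = (2 * edge_boundary U)%:E.
Proof.
rewrite mulr_natl mulr2n EFinD -{1}edge_boundary_esum.
have -> : (edge_boundary U)%:E =
    (\esum_(x in [set: G]) \sum_(s <- S) (indic2 U (x * s)%g x)%:E)%E.
  rewrite -edge_boundary_esum !esum_sum; [|by move=> *; exact: indic2_ge0..].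
  have [symS _] := genS.
  rewrite [RHS](_ : _ = \sum_(s <- S) \esum_(x in [set: G]) (indic2 U x (x * s^-1)%g)%:E)%E.
    have SV : perm_eq S [seq (s^-1)%g | s <- S].
      apply: uniq_perm; rewrite ?map_inj_uniq ?fset_uniq//; first exact: invg_inj.
      move=> s; apply/idP/mapP => [Ss|[t St ->]]; last exact: symS.
      by exists (s^-1)%g; rewrite ?invgK//; exact: symS.
    by rewrite [LHS](perm_big _ SV) big_map.
  apply: eq_bigr => s _.
  rewrite [RHS](@reindex_esum _ _ _ [set: G] [set: G] (fun x => (x * s)%g)).
    by apply: eq_esum => x _; rewrite mulgK.
  split=> //; first by move=> x y _ _; exact: mulIg.
  by move=> y _; exists (y * s^-1)%g => //; rewrite mulgVK.
rewrite -esumD; [|by move=> x _; exact: sume_ge0..].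
apply: eq_esum => x _; rewrite -big_split; apply: eq_bigr => s _ /=.
rewrite -EFinD; congr EFin; rewrite expr1 /fset_indic /indic2.
by do 2 case: (_ \in U); rewrite /= ?subrr ?subr0 ?sub0r ?normrN ?normr1 ?normr0 ?addr0 ?add0r.
Qed.

Lemma isoperimetric_ratioE U :
  isoperimetric_ratio P U = #|` U|%:R^-1 * (d^-1 * edge_boundary U).
Proof.
rewrite /isoperimetric_ratio; congr (_ * _).
have P0 x y : 0 <= P x y by rewrite /simple_random_walk; case: ifP.
have -> : [set` U] `*` ~` [set` U] = [set` U] `*`` (fun=> ~` [set` U]).
  by apply/seteqP; split.
rewrite -(esum_esum (a := fun x y => (P x y)%:E)); last by move=> x y _ _; rewrite lee_fin.
rewrite (_ : d^-1 * _ = fine (d^-1 * edge_boundary U)%:E)//; congr fine.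
rewrite EFinM -edge_boundary_esum -esumZl ?invr_ge0//; last first.
  by move=> x; exact: sume_ge0.
rewrite esum_mkcond; apply: eq_esum => x _; rewrite mem_setE.
case: ifPn => xU; last first.
  by rewrite big1 ?mule0// => s _; rewrite /indic2 (negbTE xU).
rewrite esum_mkcond (@reindex_esum _ _ _ [set: G] [set: G] (fun s => (x * s)%g)); last first.
  split=> //; first by move=> y z _ _; exact: mulgI.
  by move=> y _; exists (x^-1 * y)%g => //; rewrite mulVKg.
transitivity (\esum_(s in [set: G]) ((if s \in S then d^-1 * indic2 U x (x * s)%g else 0))%:E)%E.
  apply: eq_esum => s _; rewrite in_setC mem_setE walkE mulKg /indic2 xU /=.
  by case: (boolP ((x * s)%g \in U)); case: (boolP (s \in S)); rewrite ?mulr0 ?mulr1.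
rewrite (@esum_fsupport _ _ _ S); last 2 first.
- by move=> s; case: ifP => // _; rewrite mulr_ge0 ?invr_ge0// -lee_fin.
- by move=> s /negbTE ->.
rewrite sumEFin -EFinM mulr_sumr; congr EFin.
by apply: eq_big_seq => s ->.
Qed.

Lemma isoperimetric_ratio_ge0 U : 0 <= isoperimetric_ratio P U.
Proof.
rewrite isoperimetric_ratioE !mulr_ge0 ?invr_ge0//.
by apply: sumr_ge0 => x _; exact: sumr_ge0.
Qed.

Lemma isoperimetric_profile_ge0 n : 0 <= isoperimetric_profile P n.
Proof. by apply: inf_nonneg => _ [U _ <-]; exact: isoperimetric_ratio_ge0. Qed.

(** Testing the gap on indicators gives one direction, [gap_coarea] the other. *)
Lemma gap_isoperimetric_profile n (lam : R) : (0 < n)%N -> 0 <= lam ->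
  gap S 1 n lam <-> lam <= 2 * d * isoperimetric_profile P n.
Proof.
move=> n0 lam0; have dd0 : 0 < 2 * d by rewrite mulr_gt0.
have ratioE U : U != fset0 ->
    2 * d * isoperimetric_ratio P U * #|` U|%:R = 2 * edge_boundary U.
  rewrite -cardfs_gt0 -(ltr0n R) isoperimetric_ratioE => U0.
  by field; rewrite !gt_eqF.
have U_gt0 (U : {fset G}) : U != fset0 -> 0 < #|` U|%:R :> R.
  by rewrite ltr0n cardfs_gt0.
split=> [gapn|lamL].
  rewrite -ler_pdivrMl//; apply: lb_le_inf.
    exists (isoperimetric_ratio P [fset 1%g]%fset); exists [fset 1%g]%fset => //.
    by split; rewrite ?cardfs1// -cardfs_gt0 cardfs1.
  move=> _ [U [U0 Un] <-]; rewrite ler_pdivrMl// -(ler_pM2r (U_gt0 _ U0)) ratioE//.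
  rewrite -lee_fin -energy_fset_indic EFinM -(mass_fset_indic R U).
  apply: gapn; last by rewrite mass_fset_indic ltry.
  apply: le_trans (@support_size_fset _ _ _ U _) _; last by rewrite lee_fin ler_nat.
  by move=> x /negbTE xU; rewrite /fset_indic xU.
apply: gap_coarea => // U U0 Un.
rewrite energy_fset_indic lee_fin -ratioE// ler_pM2r ?U_gt0//.
apply: (le_trans lamL); rewrite ler_pM2l//; apply: ge_inf; last by exists U.
by exists 0 => _ [U1 _ <-]; exact: isoperimetric_ratio_ge0.
Qed.

End Isoperimetric.

(** * Growth *)

Section Growth.
Variables (G : groupType) (S : {fset G}).

Local Notation ball := (graph_ball (cayley_graph S) 1%g).

Lemma ball0 : ball 0 = [set 1%g].
Proof.
apply/seteqP; split=> [y [p [_ <- /=]]|_ ->]; last by exists [::].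
by rewrite leqn0 size_eq0 => /eqP ->.
Qed.

Lemma ballS r y : ball r.+1 y <->
  ball r y \/ exists z s, [/\ ball r z, s \in S & y = (z * s)%g].
Proof.
split=> [[p [pP <- pr]]|].
  case: (lastP p) pP pr => [|p' z] pP pr; first by left; exists [::].
  right; move: pP; rewrite rcons_path => /andP[p'P eS].
  exists (last 1%g p'), ((last 1%g p')^-1 * z)%g; split.
  - by exists p'; split=> //; move: pr; rewrite size_rcons.
  - exact: eS.
  - by rewrite last_rcons mulVKg.
case=> [[p [pP py pr]]|[z [s [[p [pP pz pr]] Ss ->]]]].
  by exists p; split=> //; exact: leqW.
exists (rcons p (z * s)%g); split; rewrite ?last_rcons ?size_rcons//.
by rewrite rcons_path pP pz /cayley_graph mulKg.
Qed.

Lemma ball_le r r' : (r <= r')%N -> ball r `<=` ball r'.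
Proof. by move=> rr' y [p [pP py pr]]; exists p; split=> //; exact: leq_trans rr'. Qed.

Lemma ballM r r' y z : ball r y -> ball r' z -> ball (r + r') (y * z)%g.
Proof.
move=> ry; elim: r' z => [|r' IH] z.
  by rewrite ball0 addn0 => ->; rewrite mulg1.
rewrite addnS => /ballS [/IH ?|[z' [s [/IH z'r Ss ->]]]]; apply/ballS; first by left.
by right; exists (y * z')%g, s; rewrite mulgA.
Qed.

Lemma finite_ball r : finite_set (ball r).
Proof.
elim: r => [|r IH]; first by rewrite ball0.
have finS : finite_set ((fun c : G * G => (c.1 * c.2)%g) @` (ball r `*` [set` S])).
  by apply/finite_image/finite_setX.
have : finite_set (ball r `|` (fun c : G * G => (c.1 * c.2)%g) @` (ball r `*` [set` S])).
  by rewrite finite_setU.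
apply: sub_finite_set => y /ballS[|[z [s [rz Ss ->]]]]; [by left|right].
by exists (z, s).
Qed.

Lemma leq_card_growth r (U : {fset G}) : [set` U] `<=` ball r -> (#|` U| <= growth S r)%N.
Proof.
move=> Ur; apply/fsubset_leq_card/fsubsetP => y /Ur ry.
by rewrite in_fset_set ?mem_set//; exact: finite_ball.
Qed.

Lemma growth0 : growth S 0 = 1%N.
Proof. by rewrite /growth ball0 fset_set1 cardfs1. Qed.

Lemma growth_gt0 r : (0 < growth S r)%N.
Proof.
rewrite -(cardfs1 (1%g : G)); apply: leq_card_growth => y; rewrite /= inE => /eqP ->.
by exists [::].
Qed.

Hypothesis genS : symmetric_generating_set S.

Lemma ball_cover g : exists r, ball r g.
Proof.
move: g; apply: (generated_ind genS).
  apply: is_subgroup => /= [|y z [r ry] [r' rz]|y [r]]; first by exists 0%N; rewrite ball0.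
    by exists (r + r')%N; exact: ballM.
  elim: r y => [y|r IH y]; first by rewrite ball0 => ->; exists 0%N; rewrite ball0 invg1.
  move=> /ballS[/IH//|[z [s [/IH [r' zr'] Ss ->]]]].
  exists (1 + r')%N; rewrite invgM; apply: ballM => //; apply/ballS; right.
  exists 1%g, (s^-1)%g; rewrite ball0 mul1g; split=> //.
  by have [symS _] := genS; exact: symS.
by move=> s Ss; exists 1%N; apply/ballS; right; exists 1%g, s; rewrite ball0 mul1g.
Qed.

Lemma ball_cover_fset (U : {fset G}) : exists r, [set` U] `<=` ball r.
Proof.
have [r rP] := choice ball_cover.
exists (\max_(g <- U) r g)%N => g /= gU; apply: ball_le (rP g).
by rewrite (big_fsetD1 g)//= leq_maxl.
Qed.

(** For one fixed [x0], [Th x0] with its label injects pairs of points of a ball into a ball of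
    comparable radius times [Z]. *)
Lemma growth_square : supermultilateral G ->
  exists C D : nat, forall r, (0 < r)%N -> (growth S r ^ 2 <= D * growth S (C * r))%N.
Proof.
move=> /(supermultilateral_coarse_product S) [W [Z [X [Th [lab cp]]]]].
have [ThW1 ThW2 labZ Thinj /(_ 1%g)[[x0 _] /= [Xx0 _]]] := cp.
have [c0 c0P] := ball_cover (Th x0 1%g 1%g).
have [c cP] := ball_cover_fset W.
have step v w k : ball k v -> w \in W -> ball (k + c) (v * w)%g.
  by move=> kv /cP; exact: ballM.
(* [c0] bounds the length of the starting value and [c] that of the elements of [W], so each
   generator in [y] or [z] costs at most [c]. *)
have Thball r r' y z : ball r y -> ball r' z -> ball (c0 + r * c + r' * c) (Th x0 y z).
  move=> ry; elim: r' z => [z|r' IH z].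
    rewrite ball0 mul0n addn0 => ->.
    elim: r y ry => [y|r IH y]; first by rewrite ball0 mul0n addn0 => ->.
    move=> /ballS[/IH|[y' [s [/IH y'r Ss ->]]]].
      by apply: ball_le; rewrite leq_add2l leq_mul2r leqnSn orbT.
    by have [w wW ->] := ThW1 x0 y' 1%g s Ss; rewrite mulSn (addnC c) addnA; exact: step.
  move=> /ballS[/IH|[z' [s [/IH z'r Ss ->]]]].
    by apply: ball_le; rewrite leq_add2l leq_mul2r leqnSn orbT.
  by have [w wW ->] := ThW2 x0 y z' s Ss; rewrite mulSn (addnC c) addnA; exact: step.
exists (c0 + (c + c))%N, #|` Z| => r r0.
pose B := fset_set (ball r); pose B' := fset_set (ball ((c0 + (c + c)) * r)).
have BP y : y \in B -> ball r y by rewrite in_fset_set => [/set_mem//|]; exact: finite_ball.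
rewrite mulnC -[growth S r]/#|` B| -[growth S (_ * r)]/#|` B'| expnS expn1.
have cardX (T T' : choiceType) (A : {fset T}) (A' : {fset T'}) :
    #|` (A `*` A')%fset| = (#|` A| * #|` A'|)%N.
  rewrite -(size_allpairs pair); apply/perm_size/uniq_perm; first exact: fset_uniq.
    by apply: allpairs_uniq; rewrite ?fset_uniq// => -[? ?] [? ?] _ _.
  move=> [x y]; rewrite in_fsetM; apply/andP/allpairsP => /= [[xA yA']|[[? ?] [? ? [-> ->]]]] //.
  by exists (x, y).
rewrite -!cardX.
pose theta (yz : G * G) := (Th x0 yz.1 yz.2, lab yz).
have <- : #|` (theta @` (B `*` B))%fset| = #|` (B `*` B)%fset|.
  apply: card_in_imfset => /= -[y z] [y' z'] _ _ E.
  suff: (x0, (y, z)) = (x0, (y', z')) by case=> -> ->.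
  by apply: Thinj => //; exact/mem_set.
apply/fsubset_leq_card/fsubsetP => _ /imfsetP[[y z] /= + ->].
rewrite !in_fsetM /= => /andP[/BP yr /BP zr]; rewrite labZ andbT.
rewrite in_fset_set; last exact: finite_ball.
apply/mem_set; apply: ball_le (Thball _ _ _ _ yr zr).
rewrite -addnA -mulnDr !mulnDl [(c * r)%N]mulnC -mulnDr leq_add2r.
by rewrite -{1}(muln1 c0) leq_mul2l r0 orbT.
Qed.

Hypothesis infG : infinite_set [set: G].

Lemma growth_unbounded n : exists r, (n <= growth S r)%N.
Proof.
have [B _ nB] := infinite_set_fset n infG.
have [r rB] := ball_cover_fset B.
by exists r; apply: leq_trans nB _; exact: leq_card_growth.
Qed.

(** The integer at which the infimum defining [inverse_growth] is attained. *)
Definition growth_radius n := ex_minn (growth_unbounded n).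

Lemma growth_radiusP n : (n <= growth S (growth_radius n))%N.
Proof. by rewrite /growth_radius; case: ex_minnP. Qed.

Lemma growth_radius_min n r : (n <= growth S r)%N -> (growth_radius n <= r)%N.
Proof. by rewrite /growth_radius; case: ex_minnP => m _ /(_ r). Qed.

Lemma growth_radius_gt0 n : (1 < n)%N -> (0 < growth_radius n)%N.
Proof.
move=> n1; have := growth_radiusP n; case: growth_radius => //.
by rewrite growth0 leqNgt n1.
Qed.

Lemma inverse_growthE (R : realType) n : inverse_growth R S n = (growth_radius n)%:R.
Proof.
apply/eqP; rewrite eq_le; apply/andP; split.
  apply: ge_inf; last by exists (growth_radius n) => //=; exact: growth_radiusP.
  by exists 0 => _ [r _ <-].
apply: lb_le_inf.
  by exists (growth_radius n)%:R, (growth_radius n) => //=; exact: growth_radiusP.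
by move=> _ [r /= nr <-]; rewrite ler_nat growth_radius_min.
Qed.

Lemma inverse_growth_doubling (R : realType) : supermultilateral G ->
  doubling_increasing (@inverse_growth R G S).
Proof.
move=> /growth_square [C [D sq]].
pose rho j := growth_radius (2 ^ j)%N.
have rho0 j : (0 < j)%N -> (0 < rho j)%N.
  by move=> j0; apply: growth_radius_gt0; rewrite -{1}(expn0 2) ltn_exp2l.
have rhoR j : (0 < j)%N -> 0 < (rho j)%:R :> R by move=> /rho0; rewrite ltr0n.
(* The ball of radius [rho (j + D)] has at least [2 ^ (j + D)] points, and [D <= 2 ^ (2 * D)]
   absorbs the factor [D] of [growth_square]. *)
have rhosq j : (0 < j)%N -> (rho (2 * j) <= C * rho (j + D))%N.
  move=> j0; have jD0 : (0 < j + D)%N by rewrite ltn_addr.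
  apply: growth_radius_min; have := sq _ (rho0 _ jD0).
  have := growth_radiusP (2 ^ (j + D))%N; rewrite -/(rho _) => le1 le2.
  have le3 : (D * 2 ^ (2 * j) <= D * growth S (C * rho (j + D)))%N.
    apply: leq_trans le2; apply: (@leq_trans ((2 ^ (j + D)) ^ 2)%N); last by rewrite leq_exp2r.
    rewrite -expnM mulnDl expnD [(j * 2)%N]mulnC [leqRHS]mulnC leq_mul//.
    by rewrite (leq_trans (ltnW (ltn_expl D (ltnSn 1))))// leq_exp2l// leq_pmulr.
  have D0 : (0 < D)%N.
    by case: (D) sq => // /(_ 1%N isT); rewrite mul0n leqn0 expn_eq0 eqn0Ngt growth_gt0.
  by rewrite leq_pmul2l in le3.
have C0 : (0 < C)%N.
  by have := leq_trans (rho0 2 isT) (rhosq 1%N isT); rewrite muln_gt0 => /andP[].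
have C0R : 0 < C%:R :> R by rewrite ltr0n.
(* The reciprocal of [rho] is decreasing, so the lemma for decreasing functions applies to it. *)
have [||||c c0 cP] := @doubling_of_square R (fun j => (rho j)%:R^-1) D C%:R^-1.
- by rewrite invr_gt0.
- by move=> j j0; rewrite invr_gt0 rhoR.
- move=> i j i0 ij; rewrite lef_pV2 ?posrE ?rhoR//; last exact: leq_trans ij.
  rewrite ler_nat; apply: growth_radius_min; apply: leq_trans (growth_radiusP _).
  by rewrite leq_exp2l.
- move=> j j0; have jD0 : (0 < j + D)%N by rewrite ltn_addr.
  rewrite -invfM lef_pV2 ?posrE ?mulr_gt0 ?rhoR ?muln_gt0//.
  by rewrite -natrM ler_nat rhosq.
exists c^-1 => n n0; rewrite !inverse_growthE -/(rho n) -/(rho (2 * n)).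
have := cP n n0; rewrite ler_pdivrMr ?rhoR// mulrC.
by rewrite ler_pdivlMr ?rhoR ?muln_gt0// -ler_pdivlMl// => ?; rewrite mulrC.
Qed.

End Growth.

Theorem proposition3p1 (R : realType) (G : groupType) (S : {fset G})
    (infG : infinite_set [set: G])
    (genS : symmetric_generating_set S)
    (smG : supermultilateral G) :
  [/\ doubling_decreasing
        (isoperimetric_profile (simple_random_walk (cayley_graph S) R)),
      doubling_decreasing
        (spectral_profile (simple_random_walk (cayley_graph S) R)) &
      doubling_increasing (@inverse_growth R G S)].
Proof.
have d0 : 0 < 2 * #|` S|%:R :> R.
  by rewrite mulr_gt0// ltr0n (generating_set_card_gt0 genS infG).
split; last exact: inverse_growth_doubling.
- apply: (gap_doubling (p := 1) _ genS infG smG d0) => // n.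
    by move=> _; exact: isoperimetric_profile_ge0.
  exact: gap_isoperimetric_profile.
- apply: (gap_doubling (p := 2) _ genS infG smG d0) => // n.
    by move=> _; exact: spectral_profile_ge0.
  exact: gap_spectral_profile.
Qed.
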